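(* For each $n\ge 2$ let $K_n=\omega_n\Delta_n$ be the regular simplex of unit volume, and let $d_n(\varepsilon)$ be the supremum of all possible distances between two subsets of $K_n$ of volume $\varepsilon$. There is a universal constant $c>0$, independent of $n$ and $\varepsilon$, such that for every $\varepsilon\in(0,\frac12)$ $$-\frac{\sqrt2}{e}\ln(2\varepsilon)\ \le\ \liminf_{n\to\infty} d_n(\varepsilon)\ \le\ \limsup_{n\to\infty} d_n(\varepsilon)\ \le\ -c\ln\varepsilon.$$
   Context: $\mathbb{R}_+=(0,+\infty)$ and $\Delta_n=\{(x_1,\dots,x_n)\in\mathbb{R}_+^n : x_1+\dots+x_n=1\}$, an $(n-1)$-dimensional regular simplex whose $(n-1)$-dimensional volume is $\frac{n\sqrt n}{n!}$. Put $\omega_n=\left(\frac{n!}{n\sqrt n}\right)^{\frac1{n-1}}$, so that $\omega_n\Delta_n$ has $(n-1)$-dimensional volume $1$; ''volume'' of subsets of $\omega_n\Delta_n$ means $(n-1)$-dimensional Lebesgue measure. The distance between non-empty sets $A,B$ is $\operatorname{dist}(A,B)=\inf_{x\in A,\,y\in B}\|x-y\|_2$ (Euclidean distance), and $d_n(\varepsilon)=\sup\{\operatorname{dist}(A,B)\}$ over measurable $A,B\subseteq K_n$ of volume exactly $\varepsilon$. *)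

(* Defs.v *)
From HB Require Import structures.
From mathcomp Require Export all_boot all_order all_algebra.
From mathcomp Require Export all_classical all_reals all_analysis.
From mathcomp Require Export measurable_realfun.
From mathcomp Require Import ring.

Set Implicit Arguments.
Unset Strict Implicit.
Unset Printing Implicit Defensive.

Import Order.TTheory GRing.Theory Num.Theory.

Local Open Scope classical_set_scope.
Local Open Scope ring_scope.

(* Lebesgue measure on the Borel sets of R^m: the m-fold product measure.     *)
Fixpoint lebesgue_tuple (R : realType) (m : nat) :
    set (m.-tuple (measurableTypeR R)) -> \bar R :=
  match m return set (m.-tuple (measurableTypeR R)) -> \bar R with
  | 0 => \d_[tuple]
  | m'.+1 => fun A =>
      (lebesgue_measure \x @lebesgue_tuple R m')%E
        [set p | A (cons_tuple p.1 p.2)]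
  end.

Definition enorm2 (R : realType) (n : nat) (x : 'rV[R]_n) : R :=
  Num.sqrt (\sum_(i < n) x ord0 i ^+ 2).

(* The infimum is taken in \bar R, so that dist A B = +oo when A or B is      *)
(* empty; otherwise it is a nonnegative real.                                 *)
Definition dist (R : realType) (n : nat) (A B : set 'rV[R]_n) : \bar R :=
  ereal_inf [set (enorm2 (x - y))%:E | x in A & y in B].

Definition simplex (R : realType) (n : nat) : set 'rV[R]_n :=
  [set x | (forall i, 0 < x ord0 i) /\ \sum_(i < n) x ord0 i = 1].
Arguments simplex : clear implicits.

(* For n >= 2, the factor that gives n-1 dimensional volume 1 to the simplex, *)
(* whose volume is n * sqrt n / n!.                                           *)
Definition omega (R : realType) (n : nat) : R :=
  (n`!%:R / (n%:R * Num.sqrt n%:R)) `^ (n.-1)%:R^-1.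

Definition unit_simplex (R : realType) (n : nat) : set 'rV[R]_n :=
  [set omega R n *: x | x in simplex R n].
Arguments unit_simplex : clear implicits.

(* An isometry from R^(n-1) onto the affine hyperplane x_1 + ... + x_n = s    *)
(* of R^n, for n >= 1: embed R^(n-1) as x_n = 0, apply the orthogonal         *)
(* reflection that exchanges e_n and - (1, ..., 1) / sqrt n, and translate    *)
(* by (s/n, ..., s/n).                                                        *)
Definition hyperplane_chart (R : realType) (n : nat) (s : R)
    (t : (n.-1).-tuple (measurableTypeR R)) : 'rV[R]_n :=
  let S : R := \sum_(k < n.-1) (tnth t k : R) in
  let r : R := Num.sqrt n%:R in
  \row_(i < n) (s / n%:R +
    (if (i < n.-1)%N then (nth 0 t i : R) - S / (r * (r + 1)) else - (S / r))).

Lemma enorm2_hyperplane_chart_sub (R : realType) (n : nat) (s : R)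
    (t u : (n.-1).-tuple (measurableTypeR R)) : (0 < n)%N ->
  enorm2 (hyperplane_chart s t - hyperplane_chart s u) =
  Num.sqrt (\sum_(k < n.-1) ((tnth t k : R) - (tnth u k : R)) ^+ 2).
Proof.
case: n => // m in t u * => _ /=; congr Num.sqrt.
pose f i : R := tnth t i; pose g i : R := tnth u i.
set r := Num.sqrt (m.+1%:R : R); set a := r * (r + 1).
have r0 : 0 < r by rewrite sqrtr_gt0 ltr0n.
have r2 : r ^+ 2 = m%:R + 1 by rewrite sqr_sqrtr ?ler0n// -natr1.
have sumC (c : R) : \sum_(i < m) c = (r ^+ 2 - 1) * c.
  by rewrite sumr_const card_ord -mulr_natl r2 addrK.
have a0 : a != 0 by rewrite lt0r_neq0// mulr_gt0// addr_gt0.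
set S := \sum_(k < m) f k; set S' := \sum_(k < m) g k.
pose w i := widen_ord (leqnSn m) i.
have chartE v (i : 'I_m) : hyperplane_chart s v ord0 (w i) = s / m.+1%:R +
    ((tnth v i : R) - (\sum_(k < m) (tnth v k : R)) / a).
  by rewrite mxE /= ltn_ord (tnth_nth (0 : R)).
have chart_lastE v : hyperplane_chart s v ord0 ord_max = s / m.+1%:R -
    (\sum_(k < m) (tnth v k : R)) / r.
  by rewrite mxE /= ltnn.
have subE (x y : 'rV[R]_m.+1) i : (x - y) ord0 i = x ord0 i - y ord0 i.
  by rewrite !mxE.
rewrite big_ord_recr /= subE !chart_lastE -/(S) -/(S').
rewrite (eq_bigr (fun i : 'I_m => (f i - g i) ^+ 2 -
  (2 * (S - S') / a * (f i - g i) - ((S - S') / a) ^+ 2))); last first.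
  by move=> i _; rewrite subE !chartE -/(f i) -/(g i) -/S -/S'; field;
    rewrite a0 nat1r pnatr_eq0.
rewrite sumrB sumrB -mulr_sumr sumrB -/S -/S' sumC.
rewrite -[X in _ = X]addr0 -addrA; congr (_ + _).
by rewrite /a; field; rewrite nat1r pnatr_eq0 !lt0r_neq0// addr_gt0.
Qed.

Lemma range_hyperplane_chart (R : realType) (n : nat) (s : R) : (0 < n)%N ->
  range (@hyperplane_chart R n s) = [set x | \sum_(i < n) x ord0 i = s].
Proof.
case: n => // m _.
set r := Num.sqrt (m.+1%:R : R).
have r0 : 0 < r by rewrite sqrtr_gt0 ltr0n.
have r2 : r ^+ 2 = m%:R + 1 by rewrite sqr_sqrtr ?ler0n// -natr1.
have sumC (c : R) : \sum_(i < m) c = (r ^+ 2 - 1) * c.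
  by rewrite sumr_const card_ord -mulr_natl r2 addrK.
have r10 : r + 1 != 0 by rewrite lt0r_neq0// addr_gt0.
pose w i := widen_ord (leqnSn m) i.
have chartE v (i : 'I_m) : hyperplane_chart s v ord0 (w i) = s / m.+1%:R +
    ((tnth v i : R) - (\sum_(k < m) (tnth v k : R)) / (r * (r + 1))).
  by rewrite mxE /= ltn_ord (tnth_nth (0 : R)).
have chart_lastE v : hyperplane_chart s v ord0 ord_max = s / m.+1%:R -
    (\sum_(k < m) (tnth v k : R)) / r.
  by rewrite mxE /= ltnn.
have nE : m.+1%:R = r ^+ 2 by rewrite r2 natr1.
apply/seteqP; split => [_ [t _ <-]|x /= xs].
  rewrite /= big_ord_recr /= chart_lastE.
  under eq_bigr do rewrite chartE.
  rewrite big_split /= sumrB !sumC nE.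
  by field; rewrite r10 lt0r_neq0.
pose S := - r * (x ord0 ord_max - s / m.+1%:R).
pose h (i : 'I_m) : R := x ord0 (w i) - s / m.+1%:R + S / (r * (r + 1)).
have hS : \sum_(i < m) h i = S.
  rewrite /h big_split /= sumrB !sumC.
  move: xs; rewrite big_ord_recr /= -/w => /(canRL (addrK _)) ->.
  by rewrite /S nE; field; rewrite r10 lt0r_neq0.
exists [tuple of mktuple h] => //; apply/rowP => j.
have tS : \sum_(k < m) tnth (mktuple h) k = S.
  by rewrite -[RHS]hS; apply: eq_bigr => k _; rewrite tnth_mktuple.
have [jm|jm] := ltnP j m.
  have -> : j = w (Ordinal jm) by exact/val_inj.
  by rewrite chartE tnth_mktuple tS /h; ring.
have -> : j = ord_max by apply/val_inj/eqP; rewrite eqn_leq -ltnS ltn_ord.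
by rewrite chart_lastE tS /S nE; field; rewrite lt0r_neq0.
Qed.

(* (n-1)-dimensional Lebesgue measurability and Lebesgue measure in the       *)
(* hyperplane x_1 + ... + x_n = s, transported along hyperplane_chart. The    *)
(* Lebesgue sigma-algebra is the completion of the Borel sigma-algebra, and   *)
(* on it the completed measure is the outer measure.                          *)
Definition hyperplane_measurable (R : realType) (n : nat) (s : R)
    (A : set 'rV[R]_n) : Prop :=
  completed_algebra_gen (@lebesgue_tuple R n.-1) (hyperplane_chart s @^-1` A).

Definition hyperplane_volume (R : realType) (n : nat) (s : R)
    (A : set 'rV[R]_n) : \bar R :=
  ((@lebesgue_tuple R n.-1)^*)%mu (hyperplane_chart s @^-1` A).

Definition subsets_of_volume (R : realType) (n : nat) (eps : R) :
    set (set 'rV[R]_n) :=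
  [set A | [/\ A `<=` unit_simplex R n,
               hyperplane_measurable (omega R n) A &
               hyperplane_volume (omega R n) A = eps%:E]].
Arguments subsets_of_volume : clear implicits.

Definition max_dist (R : realType) (n : nat) (eps : R) : \bar R :=
  ereal_sup [set dist A B | A in subsets_of_volume R n eps
                          & B in subsets_of_volume R n eps].

(* Main.v *)
From HB Require Import structures.
Require Import Defs.
From mathcomp Require Import all_boot all_order all_algebra.
From mathcomp Require Import all_classical all_reals all_analysis.
From mathcomp Require Import ring lra.

Set Implicit Arguments.
Unset Strict Implicit.
Unset Printing Implicit Defensive.

Import Order.TTheory GRing.Theory Num.Theory.
Import numFieldNormedType.Exports.
Local Open Scope classical_set_scope.
Local Open Scope ring_scope.

(** Dropping one coordinate identifies the simplex, up to an affine map of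
constant Jacobian, with the corner {t > 0, sum t < 1} of R^(n-1). Volumes of
subsets of the simplex of unit volume are therefore (n-1)! times Lebesgue
measures of subsets of the corner ([subsets_of_volume_image],
[subsets_of_volume_corner]).

Lower bound. Cut the simplex by the opposite halfspaces x_0 - x_1 > theta and
x_1 - x_0 > theta. Translation by -theta along e_0 maps the first cut onto one
half of a copy of the simplex shrunk by the factor 1 - theta. So each cut has
relative volume (1 - theta)^(n-1) / 2, which is eps for a suitable theta, and
the two cuts are at distance at least sqrt 2 * omega_n * theta ([max_dist_ge]).
Here (n-1) theta tends to - ln (2 eps), and omega_n is at least
(1 - o(1)) (n-1) / e because m! >= (m/e)^m ([omega_ge]).

Upper bound. If the coordinates of X are independent standard exponential
variables, then X / sum X is uniform on the simplex ([expP_cone]). The law of X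
has Maurey's property tau, in a form with two functions: if
u(x) v(y) <= prod_i cosh^2 ((x_i - y_i) / 4) for all x and y, then
E u * E v <= 1. In dimension one this follows by comparing level sets
([half_density_two_function], [exp_two_function_real]), and the inequality is
stable under products by Fubini ([two_function]). Since the product of the
cosh^2 is at least exp (|x - y|_2 / 16 - 1/4), two sets at Euclidean distance
eta satisfy P(A) P(B) <= exp (1/4 - eta / 16) in every dimension ([two_sets]).
This passes to the simplex because x |-> x / sum x is Lipschitz with a constant
of order 1/n where sum x >= n/2 and |x|_2 <= 9 sqrt n ([enorm2_ray_le]), and
omega_n <= n ([omega_le]). The exceptional points have a probability that tends
to 0, by an exponential moment for the sum ([expP_sum_small]) and by the
inequality for two sets itself for the norm ([expP_tnorm_gt9]). *)

(* The pushforward of the measure m by a map that mf shows to be measurable,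
   as a bundled measure. *)
Local Notation image_measure m mf :=
  (measure_function_pushforward__canonical__measure_function_Measure m mf).

(** * Lebesgue measure on tuples *)

Section cons_measure.
Context {R : realType} {m : nat}.
Local Notation RR := (measurableTypeR R).
Variable mu : {sigma_finite_measure set (m.-tuple RR) -> \bar R}.

Definition cons_pair (p : RR * m.-tuple RR) : m.+1.-tuple RR := cons_tuple p.1 p.2.

Lemma measurable_cons_pair : measurable_fun setT cons_pair.
Proof. exact: measurable_cons. Qed.

Let cm : {measure set (m.+1.-tuple RR) -> \bar R} :=
  image_measure (@lebesgue_measure R \x mu)%E measurable_cons_pair.

(** The definition follows the recursive clause of [lebesgue_tuple], so that
the two agree by computation. *)
Definition cons_measure : set (m.+1.-tuple RR) -> \bar R :=
  pushforward (@lebesgue_measure R \x mu)%E cons_pair.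

HB.instance Definition _ := Measure.copy cons_measure cm.

Lemma measurable_thead : measurable_fun setT (fun t : m.+1.-tuple RR => thead t).
Proof. exact: measurable_tnth. Qed.

Let cm_sf : sigma_finite setT cons_measure.
Proof.
have /sigma_finiteP[F [FT ndF mF]] := sigma_finiteT (@lebesgue_measure R).
have /sigma_finiteP[G [GT ndG mG]] := sigma_finiteT mu.
exists (fun n => [set t | F n (thead t) /\ G n (behead_tuple t)]).
  apply/seteqP; split => // t _.
  have : [set: RR] (thead t) by [].
  have : [set: m.-tuple RR] (behead_tuple t) by [].
  rewrite FT GT => -[k _ Gk] [n _ Fn]; exists (maxn n k) => //=; split.
    by move: (thead t) Fn; apply/subsetPset/ndF/leq_maxl.
  by move: (behead_tuple t) Gk; apply/subsetPset/ndG/leq_maxr.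
move=> n; have [mFn Fn] := mF n; have [mGn Gn] := mG n; split.
  apply: measurableI.
    by rewrite -[X in measurable X]setTI; exact: measurable_thead.
  by rewrite -[X in measurable X]setTI; exact: measurable_behead.
rewrite /cons_measure /pushforward (_ : cons_pair @^-1` _ = F n `*` G n); last first.
  by apply/seteqP; split => -[x t] /=; rewrite /cons_pair theadE/=;
    rewrite (_ : behead_tuple (cons_tuple x t) = t) //; apply/val_inj.
by rewrite product_measure1E// lte_mul_pinfty// ge0_fin_numE.
Qed.

HB.instance Definition _ := Measure_isSigmaFinite.Build _ _ _ cons_measure cm_sf.

Section integral.
Local Open Scope ereal_scope.
Variable f : m.+1.-tuple RR -> \bar R.
Hypotheses (mf : measurable_fun setT f) (f0 : forall t, 0 <= f t).

Lemma integral_cons_measure : \int[cons_measure]_t f t =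
  \int[lebesgue_measure]_x \int[mu]_t f (cons_tuple x t).
Proof.
rewrite [LHS](@ge0_integral_pushforward _ _ _ _ _ _ measurable_cons_pair)//=.
rewrite -/cons_pair fubini_tonelli1//=.
exact: (measurableT_comp mf measurable_cons_pair).
Qed.

Lemma integral_cons_measureC : \int[cons_measure]_t f t =
  \int[mu]_t \int[lebesgue_measure]_x f (cons_tuple x t).
Proof.
rewrite [LHS](@ge0_integral_pushforward _ _ _ _ _ _ measurable_cons_pair)//=.
rewrite fubini_tonelli2//=.
exact: (measurableT_comp mf measurable_cons_pair).
Qed.

End integral.
End cons_measure.

Section lebT.
Context {R : realType}.
Local Notation RR := (measurableTypeR R).

(** [lebesgue_tuple] with its structure of sigma-finite measure, which Tonelli's
theorem requires. *)
Fixpoint lebT m : {sigma_finite_measure set (m.-tuple RR) -> \bar R} :=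
  if m is m'.+1 then cons_measure (lebT m') else \d_([tuple] : 0.-tuple RR).

Lemma lebTE m : lebT m = @lebesgue_tuple R m :> (set _ -> \bar R).
Proof. by elim: m => //= m ih; rewrite /cons_measure /pushforward ih. Qed.

End lebT.

(** * Maps that scale Lebesgue measure *)

(** Both sides are measures, and they agree on half-open intervals. *)
Lemma lebesgue_measure_affine (R : realType) (k a : R) (A : set R) : 0 < k ->
  measurable (A : set (measurableTypeR R)) ->
  lebesgue_measure [set x | A (k * x + a)] = (k^-1%:E * lebesgue_measure A)%E.
Proof.
move=> k0 mA; have mf : measurable_fun setT
    (fun x => k * x + a : measurableTypeR R).
  by apply: measurable_funD => //; exact: measurable_funM.
pose mu : {measure set (measurableTypeR R) -> \bar R} :=
  image_measure (@lebesgue_measure R) mf.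
have k0' : 0 <= k by exact: ltW.
rewrite (_ : lebesgue_measure A = mscale (NngNum k0') mu A).
  by rewrite -[mscale _ _ _]/(k%:E * lebesgue_measure [set z | A (k * z + a)%R])%E muleA -EFinM mulVf ?lt0r_neq0// mul1e.
apply: lebesgue_measure_unique => // _ [[x y] _ <-].
transitivity (k%:E * lebesgue_measure [set z | `]x, y]%classic (k * z + a)%R])%E => //.
rewrite [X in (_ * lebesgue_measure X)%E](_ : _ =`](x - a) / k, (y - a) / k]%classic).
  rewrite !lebesgue_measure_itv/= !lte_fin ltr_pM2r ?invr_gt0// ltrD2r.
  case: ifPn => _; last by rewrite mule0.
  by rewrite -!EFinB -EFinM; congr EFin; field; rewrite lt0r_neq0.
apply/seteqP; split => z /=; rewrite !in_itv/= -ltrBlDr -lerBrDr;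
  by rewrite ltr_pdivrMr// ler_pdivlMr// ![z * k]mulrC.
Qed.

Section lebT_cons.
Context {R : realType} {m : nat}.
Local Notation RR := (measurableTypeR R).
Local Notation leb := (@lebesgue_measure R).
Local Open Scope ereal_scope.

Lemma measurable_cons_section x (A : set (m.+1.-tuple RR)) :
  measurable A -> measurable [set t | A (cons_tuple x t)].
Proof.
move=> mA; rewrite -[X in measurable X]setTI.
exact: (measurable_cons (measurable_cst x) (@measurable_id _ _ setT)).
Qed.

Lemma measurable_head_section t (A : set (m.+1.-tuple RR)) :
  measurable A -> measurable [set x | A (cons_tuple x t)].
Proof.
move=> mA; rewrite -[X in measurable X]setTI.
exact: (measurable_cons (@measurable_id _ _ setT) (measurable_cst t)).
Qed.

Lemma measurable_lebT_section (A : set (m.+1.-tuple RR)) : measurable A ->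
  measurable_fun setT (fun x => lebT m [set t | A (cons_tuple x t)]).
Proof.
move=> mA; have mA' : measurable (cons_pair @^-1` A : set (RR * m.-tuple RR)%type).
  by rewrite -[X in measurable X]setTI; exact: measurable_cons_pair.
rewrite (_ : (fun x => _) = lebT m \o xsection (cons_pair @^-1` A)).
  exact: measurable_fun_xsection.
by apply/funext => x /=; congr (lebT m _); apply/seteqP; split => t;
  rewrite /xsection/= inE.
Qed.

Lemma measurable_leb_section (A : set (m.+1.-tuple RR)) : measurable A ->
  measurable_fun setT (fun t => leb [set x | A (cons_tuple x t)]).
Proof.
move=> mA; have mA' : measurable (cons_pair @^-1` A : set (RR * m.-tuple RR)%type).
  by rewrite -[X in measurable X]setTI; exact: measurable_cons_pair.
rewrite (_ : (fun t => _) = leb \o ysection (cons_pair @^-1` A)).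
  exact: measurable_fun_ysection.
by apply/funext => x /=; congr (leb _); apply/seteqP; split => t;
  rewrite /ysection/= inE.
Qed.

Lemma lebT_cons (A : set (m.+1.-tuple RR)) : measurable A ->
  lebT m.+1 A = \int[leb]_x lebT m [set t | A (cons_tuple x t)].
Proof.
move=> mA; rewrite -[in LHS](setIT A) -integral_indic//= integral_cons_measure//.
  apply: eq_integral => x _.
  have mAx := measurable_cons_section x mA.
  by rewrite -[RHS](congr1 (lebT m) (setIT _)) -integral_indic.
exact/measurable_EFinP.
Qed.

Lemma lebT_consC (A : set (m.+1.-tuple RR)) : measurable A ->
  lebT m.+1 A = \int[lebT m]_t leb [set x | A (cons_tuple x t)].
Proof.
move=> mA; rewrite -[in LHS](setIT A) -integral_indic//= integral_cons_measureC//.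
  apply: eq_integral => t _.
  have mAt := measurable_head_section t mA.
  by rewrite -[RHS](congr1 leb (setIT _)) -integral_indic.
exact/measurable_EFinP.
Qed.

End lebT_cons.

Section scales.
Context {R : realType}.
Local Notation RR := (measurableTypeR R).
Local Notation leb := (@lebesgue_measure R).

(** T multiplies the Lebesgue measure of preimages by c; for a linear T,
c = |det T|^-1. *)
Definition scales m (c : R) (T : m.-tuple RR -> m.-tuple RR) :=
  measurable_fun setT T /\
  forall A, measurable A -> lebT m (T @^-1` A) = (c%:E * lebT m A)%E.

Lemma scales_comp m (c d : R) (T U : m.-tuple RR -> m.-tuple RR) :
  scales c T -> scales d U -> scales (c * d) (T \o U).
Proof.
move=> [mT cT] [mU dU]; split; first exact: measurableT_comp.
move=> A mA; rewrite comp_preimage dU; last first.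
  by rewrite -[X in measurable X]setTI; exact: mT.
by rewrite cT// muleA -EFinM mulrC.
Qed.

Lemma eq_scales m (c : R) (T U : m.-tuple RR -> m.-tuple RR) :
  T =1 U -> scales c T -> scales c U.
Proof. by move=> /funext ->. Qed.

Definition head_affine m (k : R) (g : m.-tuple RR -> R)
    (p : m.+1.-tuple RR) : m.+1.-tuple RR :=
  cons_tuple (k * (thead p : R) + g (behead_tuple p)) (behead_tuple p).

Lemma behead_cons m (x : RR) (t : m.-tuple RR) :
  behead_tuple (cons_tuple x t) = t.
Proof. exact/val_inj. Qed.

(** With the other coordinates fixed, this is an affine map of the line. *)
Lemma scales_head_affine m (k : R) (g : m.-tuple RR -> R) : 0 < k ->
  measurable_fun setT g -> scales k^-1 (head_affine k g).
Proof.
move=> k0 mg.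
have mT : measurable_fun setT (head_affine k g).
  apply: measurable_cons; last exact: measurable_behead.
  apply: measurable_funD.
    by apply: measurable_funM => //; exact: measurable_thead.
  by apply: measurableT_comp => //; exact: measurable_behead.
split=> // A mA; have mTA : measurable (head_affine k g @^-1` A).
  by rewrite -[X in measurable X]setTI; exact: mT.
rewrite !lebT_consC// -ge0_integralZl//.
- apply: eq_integral => t _.
  rewrite -(lebesgue_measure_affine (g t) k0)//; last first.
    exact: measurable_head_section.
  by congr (leb _); apply/seteqP; split => x; rewrite /head_affine /= theadE behead_cons.
- exact: measurable_leb_section.
- by rewrite lee_fin invr_ge0 ltW.
Qed.

Definition skew m (U : RR -> m.-tuple RR -> m.-tuple RR)
    (p : m.+1.-tuple RR) : m.+1.-tuple RR :=
  cons_tuple (thead p) (U (thead p) (behead_tuple p)).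

(** Tonelli with the first coordinate fixed. *)
Lemma scales_skew m (c : R) (U : RR -> m.-tuple RR -> m.-tuple RR) : 0 <= c ->
  measurable_fun setT (skew U) -> (forall x, scales c (U x)) ->
  scales c (skew U).
Proof.
move=> c0 mU cU; split=> // A mA.
have mUA : measurable (skew U @^-1` A).
  by rewrite -[X in measurable X]setTI; exact: mU.
rewrite !lebT_cons// -ge0_integralZl//.
- apply: eq_integral => x _; rewrite -(cU x).2; last first.
    exact: measurable_cons_section.
  by congr (lebT _ _); apply/seteqP; split => t; rewrite /skew/= theadE behead_cons.
- exact: measurable_lebT_section.
Qed.

Definition tsum m (t : m.-tuple RR) : R := \sum_(k < m) (tnth t k : R).

Lemma tsum_cons m (x : RR) (t : m.-tuple RR) :
  tsum (cons_tuple x t) = (x : R) + tsum t.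
Proof.
by rewrite /tsum big_ord_recl tnth0; congr (_ + _); apply: eq_bigr => i _; rewrite tnthS.
Qed.

Lemma measurable_tsum m : measurable_fun setT (@tsum m).
Proof. by apply: measurable_sum => i; exact: measurable_tnth. Qed.

Definition affine m (k a : R) (t : m.-tuple RR) : m.-tuple RR :=
  map_tuple (fun x : R => k * x + a) t.

Lemma measurable_affine m (k : R) (a : m.-tuple RR -> R) :
  measurable_fun setT a -> measurable_fun setT (fun t => affine k (a t) t).
Proof.
move=> ma; apply/measurable_fun_tnthP => i.
rewrite (_ : _ \o _ = (fun t => k * (tnth t i : R) + a t)).
  by apply: measurable_funD => //; apply: measurable_funM => //; exact: measurable_tnth.
by apply/funext => t /=; rewrite tnth_map.
Qed.

(** One coordinate at a time. *)
Lemma scales_affine m (k a : R) : 0 < k -> scales (k ^- m) (@affine m k a).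
Proof.
move=> k0; elim: m => [|m ih].
  split=> [|A mA]; first exact: measurable_affine.
  rewrite expr0 invr1 mul1e; congr (lebT _ _).
  by apply/seteqP; split => t /=; rewrite (tuple0 t) (tuple0 (affine _ _ _)).
apply: (@eq_scales _ _ (skew (fun _ => affine k a) \o head_affine k (fun=> a))).
  move=> t /=; rewrite /skew /head_affine theadE behead_cons.
  by rewrite [in RHS](tuple_eta t); exact/val_inj.
rewrite exprSr invfM; apply: scales_comp; last exact: scales_head_affine.
apply: scales_skew => //; first by rewrite invr_ge0 exprn_ge0// ltW.
apply: measurable_cons; first exact: measurable_thead.
by apply: measurableT_comp; [exact: ih.1|exact: measurable_behead].
Qed.

(** v |-> v + (b - a * sum v) (1, ..., 1): up to a dilation, the relation between
the chart of the hyperplane and the first n-1 coordinates. *)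
Definition sum_shift m (a b : R) (t : m.-tuple RR) : m.-tuple RR :=
  affine 1 (b - a * tsum t) t.

Lemma tsum_affine m (k a : R) (t : m.-tuple RR) :
  tsum (affine k a t) = k * tsum t + m%:R * a.
Proof.
rewrite /tsum mulr_sumr -[m in m%:R]card_ord mulr_natl -sumr_const -big_split/=.
by apply: eq_bigr => i _; rewrite tnth_map.
Qed.

(** A rank-one perturbation of the identity has determinant 1 - m a. It is
a product of three elementary maps when the sum of the coordinates replaces the
first one: the other coordinates are then shifted by a function of this sum, and
the new first coordinate is an affine function of the sum. *)
Lemma scales_sum_shift m (a b : R) : 0 < 1 - m%:R * a ->
  scales (1 - m%:R * a)^-1 (@sum_shift m a b).
Proof.
case: m => [_|m k0].
  apply: (@eq_scales _ _ (@affine 0 1 0)); last first.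
    by rewrite mul0r subr0 -[1^-1]/(1 ^- 0); exact: scales_affine.
  by move=> t; rewrite (tuple0 (affine _ _ _)) (tuple0 (sum_shift _ _ _)).
set k := 1 - _ in k0 *.
(* (x, t) |-> (sum, t) |-> (sum, t') |-> (x', t'), where x' is expressed by the
   first sum and the sum of t'. *)
pose T1 := head_affine 1 (@tsum m).
pose T2 := @skew m (fun x => affine 1 (b - a * (x : R))).
pose T3 := head_affine k (fun t : m.-tuple RR => m.+1%:R * b - tsum t).
apply: (@eq_scales _ _ (T3 \o (T2 \o T1))).
  move=> t /=; rewrite /T3 /T2 /T1 /skew /head_affine theadE !behead_cons theadE.
  rewrite /sum_shift; have [x [t' ->]] : exists x t', t = cons_tuple x t'.
    by exists (thead t), (behead_tuple t); rewrite [LHS]tuple_eta; exact/val_inj.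
  rewrite theadE behead_cons tsum_cons tsum_affine mul1r.
  apply/val_inj => /=; congr (_ :: _).
  by rewrite /k; ring.
rewrite -[k^-1]mulr1; apply: scales_comp.
  apply: scales_head_affine => //; apply: measurable_funB => //; exact: measurable_tsum.
rewrite -[1]mulr1; apply: scales_comp; last first.
  by rewrite -[X in scales X]invr1; apply: scales_head_affine => //; exact: measurable_tsum.
apply: scales_skew => //.
  apply: measurable_cons; first exact: measurable_thead.
  rewrite (_ : (fun x => _) = (fun t => affine 1 t.1 t.2) \o
     (fun t : m.+1.-tuple RR => (b - a * (thead t : R) : RR, behead_tuple t))) //.
  apply: measurableT_comp; last first.
    apply/measurable_fun_pairP; split => /=; last exact: measurable_behead.
    by apply: measurable_funB => //; apply: measurable_funM => //; exact: measurable_thead.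
  apply/measurable_fun_tnthP => i.
  rewrite (_ : _ \o _ = (fun t => 1 * (tnth t.2 i : R) + t.1)).
    apply: measurable_funD => //; apply: measurable_funM => //.
    apply: (@measurableT_comp _ _ _ _ _ _ (fun x => tnth x i)) => //; exact: measurable_tnth.
  by apply/funext => t /=; rewrite tnth_map.
by move=> x; have := @scales_affine m 1 (b - a * (x : R)) ltr01; rewrite expr1n invr1.
Qed.

Definition swap2 m (t : m.+2.-tuple RR) : m.+2.-tuple RR :=
  cons_tuple (thead (behead_tuple t))
    (cons_tuple (thead t) (behead_tuple (behead_tuple t))).

(** Tonelli in the first two coordinates. *)
Lemma scales_swap2 m : scales 1 (@swap2 m).
Proof.
have ms : measurable_fun setT (@swap2 m).
  apply: measurable_cons.
    by apply: measurableT_comp; [exact: measurable_thead|exact: measurable_behead].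
  apply: measurable_cons; first exact: measurable_thead.
  by apply: measurableT_comp; exact: measurable_behead.
split=> // A mA; have msA : measurable (@swap2 m @^-1` A).
  by rewrite -[X in measurable X]setTI; exact: ms.
rewrite mul1e; pose A' := [set p : (RR * RR) * m.-tuple RR |
  A (cons_tuple p.1.1 (cons_tuple p.1.2 p.2))].
have mA' : measurable A'.
  rewrite -[X in measurable X]setTI.
  have mf : measurable_fun setT (fun p : (RR * RR) * m.-tuple RR =>
      cons_tuple p.1.1 (cons_tuple p.1.2 p.2)).
    apply: measurable_cons; first exact: measurableT_comp.
    by apply: measurable_cons => //; exact: measurableT_comp.
  exact: mf.
pose f p := lebT m (xsection A' p).
have mf : measurable_fun setT f by exact: measurable_fun_xsection.
transitivity (\int[leb]_x \int[leb]_y f (y, x))%E.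
  rewrite lebT_cons//; apply: eq_integral => x _.
  rewrite lebT_cons//; last exact: measurable_cons_section.
  apply: eq_integral => y _; rewrite /f; congr (lebT m _).
  by apply/seteqP; split => t; rewrite /xsection/= inE /A'/= /swap2 !theadE !behead_cons.
transitivity (\int[leb]_y \int[leb]_x f (y, x))%E; first exact/esym/fubini_tonelli.
by rewrite lebT_cons.
Qed.

End scales.

(** * Volumes in the corner simplex *)

Section simplex_volume.
Context {R : realType}.
Local Notation RR := (measurableTypeR R).
Local Notation leb := (@lebesgue_measure R).

(** The simplex t > 0, sum t < rho, with one vertex at the origin. *)
Definition corner m (rho : R) : set (m.-tuple RR) :=
  [set t | (forall i, 0 < (tnth t i : R)) /\ tsum t < rho].
Arguments corner : clear implicits, simpl never.

Lemma measurable_corner m rho : measurable (corner m rho).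
Proof.
rewrite /corner (_ : [set t | _] =
   (\bigcap_(i in [set: 'I_m]) [set t : m.-tuple RR | 0 < (tnth t i : R)]) `&`
   [set t | tsum t < rho]).
  apply: measurableI.
    apply: fin_bigcap_measurable => // i _.
    rewrite (_ : [set t | _] = (fun t : m.-tuple RR => tnth t i : R) @^-1` `]0, +oo[).
      by rewrite -[X in measurable X]setTI; exact: measurable_tnth.
    by apply/seteqP; split => t /=; rewrite in_itv/= andbT.
  rewrite (_ : [set t | _] = (@tsum _ m) @^-1` `]-oo, rho[).
    by rewrite -[X in measurable X]setTI; exact: measurable_tsum.
  by apply/seteqP; split => t /=; rewrite in_itv.
by apply/seteqP; split => t /= [H1 H2]; split => // i *; exact: H1.
Qed.

Lemma tuple_cons_ex m (p : m.+1.-tuple RR) : exists x t, p = cons_tuple x t.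
Proof. by exists (thead p), (behead_tuple p); rewrite [LHS]tuple_eta; exact/val_inj. Qed.

Lemma corner_cons m rho (x : RR) (t : m.-tuple RR) :
  corner m.+1 rho (cons_tuple x t) <-> 0 < (x : R) /\ corner m (rho - (x : R)) t.
Proof.
rewrite /corner /= tsum_cons ltrBrDl; split => [[H1 H2]|[H1 [H2 H3]]].
  by split; [have := H1 ord0; rewrite tnth0|split => // i; have := H1 (lift ord0 i); rewrite tnthS].
by split => // i; case: (unliftP ord0 i) => [j|] ->; rewrite ?tnthS ?tnth0.
Qed.

Lemma corner_empty rho : 0 < rho -> corner 0 rho = setT.
Proof.
move=> rho0; apply/seteqP; split => // t _.
by split => [[]//|]; rewrite /tsum big_ord0.
Qed.

Lemma integral_pow_sub (rho : R) m : 0 < rho ->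
  (\int[leb]_(x in `]0%R, rho[) ((rho - x) ^+ m / m`!%:R)%:E =
   (rho ^+ m.+1 / m.+1`!%:R)%:E)%E.
Proof.
move=> rho0.
pose f (x : R) : R := (rho - x) ^+ m / m`!%:R.
pose F (x : R) : R := - ((rho - x) ^+ m.+1 / m.+1`!%:R).
have cE k : continuous (fun x : R => (rho - x) ^+ k).
  move=> x; apply: (@continuous_comp _ _ _ (fun x => rho - x) (fun x => x ^+ k)).
    by apply: cvgB; [exact: cvg_cst|exact: cvg_id].
  exact: exprn_continuous.
have cf : continuous f by move=> x; apply: cvgMl; exact: cE.
have cF : continuous F by move=> x; apply: cvgN; apply: cvgMl; exact: cE.
have dF (x : R) : is_derive x 1 F (f x).
  have d1 : is_derive x 1 (fun x => rho - x) (-1).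
    by apply: is_derive_eq; rewrite add0r mul1r.
  have := is_deriveX m.+1 d1 => d2.
  have := is_deriveZ (- (m.+1`!%:R)^-1) d2 => d3.
  rewrite (_ : F = - (m.+1`!%:R)^-1 \*: ((fun x : R => rho - x) ^+ m.+1)); last first.
    by apply/funext => y; rewrite /F /= fctE /GRing.scale/= mulNr mulrC.
  apply: is_derive_eq d3 _; rewrite /f /= factS natrM.
  rewrite /GRing.scale/=; field.
  by rewrite nat1r !pnatr_eq0 -lt0n fact_gt0.
rewrite -(@integral_itv_bndoo _ _ _ _ true false); last first.
  apply: (@measurable_funTS _ _ _ _ _ _); apply/measurable_EFinP; exact: continuous_measurable_fun.
rewrite -[LHS]/(\int[leb]_(x in `[0%R, rho]) (f x)%:E)%E (@continuous_FTC2 _ f F)//.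
- by rewrite /F subrr expr0n/= mul0r oppr0 addr0 -EFinB add0r opprK.
- exact: continuous_subspaceT.
- split.
  + by move=> x _; have [] := dF x.
  + exact/cvg_at_right_filter/cF.
  + exact/cvg_at_left_filter/cF.
- by move=> x _; rewrite derive1E; have [_ ->] := dF x.
Qed.

Lemma lebT_corner m (rho : R) : 0 < rho ->
  lebT m (corner m rho) = (rho ^+ m / m`!%:R)%:E.
Proof.
elim: m rho => [|m ih] rho rho0.
  by rewrite corner_empty//= diracT expr0 divr1.
rewrite lebT_cons; last exact: measurable_corner.
rewrite -integral_pow_sub// [RHS]integral_mkcond; apply: eq_integral => x _.
rewrite patchE; case: ifPn => [|].
  rewrite inE/= in_itv/= => /andP[x0 xr].
  rewrite -ih ?subr_gt0//; congr (lebT m _).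
  by apply/seteqP; split => t /=; rewrite corner_cons => //; case.
move=> /negP xN; transitivity (@lebT R m set0); last exact: measure0.
congr (lebT m _).
apply/seteqP; split => // t /=; rewrite corner_cons => -[x0 [tp xt]].
apply: xN; rewrite inE/= in_itv/= x0/= -subr_gt0; apply: le_lt_trans xt.
by apply: sumr_ge0 => i _; exact/ltW/tp.
Qed.

(** The cut is the preimage of a corner of size 1 - theta under
(x, y, t) |-> (2 y, x - y - theta, t): the sum of the new coordinates is
x + y + sum t - theta. This map halves volumes. *)
Lemma lebT_corner_half m (theta : R) : 0 <= theta -> theta < 1 ->
  lebT m.+2 [set t | corner m.+2 1 t /\
    theta < (thead t : R) - (thead (behead_tuple t) : R)] =
  (2^-1 * ((1 - theta) ^+ m.+2 / m.+2`!%:R))%:E.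
Proof.
move=> t0 t1.
pose T := head_affine 2 (fun=> 0 : R) \o (@swap2 R m \o
  head_affine 1 (fun t : m.+1.-tuple RR => - (thead t : R) - theta)).
have [mT sT] : scales (2^-1 * (1 * 1)) T.
  apply: scales_comp; first exact: scales_head_affine.
  apply: scales_comp; first exact: scales_swap2.
  rewrite -[X in scales X]invr1; apply: scales_head_affine => //.
  apply: measurable_funB => //.
  by apply: measurableT_comp => //; exact: measurable_thead.
have t1' : 0 < 1 - theta by rewrite subr_gt0.
rewrite -[X in (X * _)%:E]mulr1 -[X in (_ * X * _)%:E]mulr1 EFinM -lebT_corner// -sT; last exact: measurable_corner.
congr (lebT _ _); apply/seteqP; split => p.
  have [x [p' ->]] := tuple_cons_ex p; have [y [t ->]] := tuple_cons_ex p'.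
  rewrite /T/= /head_affine /swap2/= !(theadE, behead_cons) => -[+ xy].
  rewrite !corner_cons => -[x0 [y0 [tp tr]]]; split; first by rewrite addr0 mulr_gt0.
  split; first by rewrite mul1r; lra.
  by split => //; rewrite addr0 mul1r; lra.
have [x [p' ->]] := tuple_cons_ex p; have [y [t ->]] := tuple_cons_ex p'.
rewrite /T/= /head_affine /swap2/= !(theadE, behead_cons).
rewrite !corner_cons addr0 mul1r => -[y0 [xy [tp tr]]].
have y0' : 0 < (y : R) by rewrite -(pmulr_rgt0 (y : R) (@ltr0n R 2)).
split; last by lra.
by split; [lra|split => //; split => //; lra].
Qed.

End simplex_volume.
Arguments corner {R} m rho.

(** * The chart of the hyperplane in corner coordinates *)

Section chart.
Context {R : realType}.
Local Notation RR := (measurableTypeR R).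

(** The point of the standard simplex with free coordinates t; the last
coordinate is determined by the others. *)
Definition simplex_point m (t : m.-tuple RR) : 'rV[R]_m.+1 :=
  \row_i (if (i < m)%N then nth 0 t i else 1 - tsum t).

Lemma simplex_point_lift m (t : m.-tuple RR) (i : 'I_m) :
  simplex_point t ord0 (widen_ord (leqnSn m) i) = tnth t i.
Proof. by rewrite mxE /= ltn_ord -tnth_nth. Qed.

Lemma simplex_point_last m (t : m.-tuple RR) : simplex_point t ord0 ord_max = 1 - tsum t.
Proof. by rewrite mxE /= ltnn. Qed.

Lemma simplex_pointP m (t : m.-tuple RR) :
  simplex R m.+1 (simplex_point t) <-> corner m 1 t.
Proof.
rewrite /simplex /corner /=; split => [[p s]|[p s]].
  split=> [i|]; first by rewrite -simplex_point_lift.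
  by have := p ord_max; rewrite simplex_point_last subr_gt0.
split; last first.
  rewrite big_ord_recr /= simplex_point_last.
  by under eq_bigr do rewrite simplex_point_lift; rewrite -/(tsum t) addrC subrK.
move=> i; have [im|im] := ltnP i m.
  by have := p (Ordinal im); rewrite -simplex_point_lift; congr (_ < simplex_point t _ _); exact/val_inj.
have -> : i = ord_max by apply/val_inj/eqP; rewrite eqn_leq -ltnS ltn_ord.
by rewrite simplex_point_last subr_gt0.
Qed.

Lemma sum_shiftK m (a a' b b' : R) (t : m.-tuple RR) :
  a + a' = m%:R * a * a' -> b + b' = a * m%:R * b' ->
  sum_shift a b (sum_shift a' b' t) = t.
Proof.
move=> ha hb; apply: eq_from_tnth => i.
rewrite /sum_shift !tnth_map tsum_affine.
set x : R := tnth t i; set S := tsum t.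
rewrite !mul1r; apply/eqP; rewrite -subr_eq0; apply/eqP.
transitivity ((b + b' - a * m%:R * b') - (a + a' - m%:R * a * a') * S); first by ring.
by rewrite ha hb !subrr mul0r subr0.
Qed.

Section fixed_scale.
Variables (m : nat) (s : R).
Hypothesis s0 : 0 < s.

Let r : R := Num.sqrt m.+1%:R.
Let a : R := (r * (r + 1))^-1.
Let b : R := s / m.+1%:R.

Let r0 : 0 < r. Proof. by rewrite sqrtr_gt0 ltr0n. Qed.
Let r2 : m%:R = r ^+ 2 - 1.
Proof. by rewrite sqr_sqrtr ?ler0n// -natr1 addrK. Qed.
Let r10 : 0 < r + 1. Proof. by rewrite addr_gt0. Qed.

(** Corner coordinates of the point of parameter t in the chart of the
hyperplane x_1 + ... + x_n = s; [of_corner] is the inverse map. *)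
Definition to_corner (t : m.-tuple RR) : m.-tuple RR :=
  affine s^-1 0 (sum_shift a b t).

Definition of_corner (v : m.-tuple RR) : m.-tuple RR :=
  sum_shift (- (a * r)) (- b - a * r * m%:R * b) (affine s 0 v).

Let affineK (k : R) (t : m.-tuple RR) : k != 0 -> affine k^-1 0 (affine k 0 t) = t.
Proof.
move=> k0; apply: eq_from_tnth => i; rewrite !tnth_map !addr0.
by rewrite mulrA mulVf// mul1r.
Qed.

Let aE : 1 - m%:R * a = r^-1.
Proof.
by rewrite r2 /a; field; rewrite !lt0r_neq0.
Qed.

Lemma to_cornerK : cancel to_corner of_corner.
Proof.
move=> t; rewrite /of_corner /to_corner.
rewrite -[X in affine X 0]invrK affineK ?invr_neq0 ?lt0r_neq0//.
rewrite sum_shiftK//; last by ring.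
by rewrite r2 /a; field; rewrite !lt0r_neq0.
Qed.

Lemma of_cornerK : cancel of_corner to_corner.
Proof.
move=> t; rewrite /of_corner /to_corner sum_shiftK ?affineK ?lt0r_neq0//.
  by rewrite r2 /a; field; rewrite !lt0r_neq0.
by rewrite r2 /a; field; rewrite !lt0r_neq0.
Qed.

Lemma scales_to_corner : scales (s ^+ m * r) to_corner.
Proof.
have := @scales_comp _ m _ _ _ _ (@scales_affine R m s^-1 0 _) (@scales_sum_shift R m a b _).
rewrite aE !invrK exprVn invrK; apply; by rewrite ?invr_gt0.
Qed.

Lemma measurable_of_corner : measurable_fun setT of_corner.
Proof.
apply: measurableT_comp; last by apply: measurable_affine.
apply: measurable_affine; apply: measurable_funB => //.
by apply: measurable_funM => //; exact: measurable_tsum.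
Qed.

Lemma hyperplane_chartE (t : m.-tuple RR) :
  hyperplane_chart (n := m.+1) s t = s *: simplex_point (to_corner t).
Proof.
apply/rowP => i; rewrite 2![in RHS]mxE /hyperplane_chart [in LHS]mxE /=.
rewrite -/r -/b -/(tsum t); case: ifPn => im.
  rewrite -[i : nat]/(nat_of_ord (Ordinal im)) -!tnth_nth !tnth_map addr0 mulrA divff ?lt0r_neq0// !mul1r.
  by rewrite /a; ring.
rewrite tsum_affine mulr0 addr0 /sum_shift tsum_affine mul1r r2 /b -natr1 r2 /a.
by field; rewrite !lt0r_neq0// subrK exprn_gt0.
Qed.

End fixed_scale.

Lemma omega_gt0 n : (0 < n)%N -> 0 < omega R n.
Proof.
move=> n0; apply: powR_gt0; rewrite divr_gt0 ?mulr_gt0 ?sqrtr_gt0 ?ltr0n//.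
exact: fact_gt0.
Qed.

(** omega_n is the (n-1)-st root of (n-1)! / sqrt n, with n = m + 1. The factor
sqrt n is compensated by the Jacobian in [scales_to_corner]. *)
Lemma omega_pow m : (0 < m)%N -> omega R m.+1 ^+ m * Num.sqrt m.+1%:R = m`!%:R.
Proof.
move=> m0; rewrite /omega -powR_mulrn ?powR_ge0// -powRrM mulVf ?pnatr_eq0 -?lt0n//.
have r0 : 0 < Num.sqrt (m.+1%:R : R) by rewrite sqrtr_gt0 ltr0n.
rewrite powRr1; last by rewrite divr_ge0 ?mulr_ge0 ?ler0n ?ltW.
rewrite factS natrM; field.
by rewrite nat1r pnatr_eq0/= lt0r_neq0.
Qed.

End chart.

(** * Subsets of given volume and the two halfspace cuts *)

Section volume.
Context {R : realType}.
Local Notation RR := (measurableTypeR R).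

Lemma simplex_point_inj m : injective (@simplex_point R m).
Proof.
by move=> t u tu; apply: eq_from_tnth => i; rewrite -!simplex_point_lift tu.
Qed.

Lemma scales_omega m : (0 < m)%N -> scales m`!%:R (@to_corner R m (omega R m.+1)).
Proof.
by move=> m0; rewrite -omega_pow//; apply: scales_to_corner; exact: omega_gt0.
Qed.

Lemma subsets_of_volume_image m (B : set (m.-tuple RR)) (eps : R) : (0 < m)%N ->
  measurable B -> B `<=` corner m 1 -> (m`!%:R%:E * lebT m B)%E = eps%:E ->
  subsets_of_volume R m.+1 eps [set omega R m.+1 *: simplex_point t | t in B].
Proof.
move=> m0 mB B1 Beps; set w := omega R m.+1.
have w0 : 0 < w by exact: omega_gt0.
have preE : hyperplane_chart (n := m.+1) w @^-1` [set w *: simplex_point t | t in B] =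
    to_corner w @^-1` B.
  apply/seteqP; split => t /=.
    move=> [u Bu]; rewrite hyperplane_chartE// => /(scalerI (lt0r_neq0 w0)).
    by move=> /simplex_point_inj <-.
  by move=> Bt; exists (to_corner w t) => //; rewrite hyperplane_chartE.
have [mT sT] := scales_omega m0.
have mTB : measurable (to_corner w @^-1` B).
  by rewrite -[X in measurable X]setTI; exact: mT.
split.
- by move=> _ [t Bt <-]; exists (simplex_point t) => //; exact/simplex_pointP/B1.
- rewrite /hyperplane_measurable preE; exists (to_corner w @^-1` B) => //.
  exists set0; last by rewrite setU0.
  by rewrite -lebTE; exact: negligible_set0.
- rewrite /hyperplane_volume preE -lebTE measurable_mu_extE//.
  exact: (etrans (sT _ mB) Beps).
Qed.

(** A set of the completed sigma-algebra contains a Borel set of the same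
measure; passing to it can only increase distances. *)
Lemma subsets_of_volume_corner m (A : set 'rV[R]_m.+1) (eps : R) : (0 < m)%N ->
  subsets_of_volume R m.+1 eps A ->
  exists B : set (m.-tuple RR), [/\ measurable B, B `<=` corner m 1,
    (eps%:E <= m`!%:R%:E * lebT m B)%E &
    forall t, B t -> A (omega R m.+1 *: simplex_point t)].
Proof.
move=> m0 [AK]; rewrite /hyperplane_measurable /hyperplane_volume -lebTE.
set w := omega R m.+1 => -[/= A0 mA0 [N [N' [mN' N'0 NN']] A0N]] volA.
have w0 : 0 < w by exact: omega_gt0.
have A0A t : A0 t -> A (hyperplane_chart (n := m.+1) w t).
  by move=> A0t; suff : (hyperplane_chart (n := m.+1) w @^-1` A) t by []; rewrite -A0N; left.
have [mT sT] := scales_omega m0.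
pose B := @of_corner R m w @^-1` A0.
have mB : measurable B.
  by rewrite -[X in measurable X]setTI; exact: measurable_of_corner.
have BA t : B t -> A (w *: simplex_point t).
  by move=> /A0A; rewrite hyperplane_chartE// of_cornerK.
exists B; split => //.
  move=> t /BA /AK [x sx] /(scalerI (lt0r_neq0 w0)) xt.
  by apply/simplex_pointP; rewrite -xt.
rewrite -sT// /B -comp_preimage (_ : _ \o _ = id); last first.
  by apply/funext => t /=; rewrite to_cornerK.
rewrite preimage_id -volA -A0N.
apply: (@le_trans _ _ ((lebT m)^*%mu (A0 `|` N'))).
  by apply: le_mu_ext; exact: setUS.
rewrite measurable_mu_extE; last exact: measurableU.
apply: (le_trans (measureU2 _ mA0 mN')).
by rewrite [X in (_ + X)%E]N'0 adde0.
Qed.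

(** Cauchy-Schwarz with the unit vector (e_i - e_j) / sqrt 2. *)
Lemma enorm2_ge_coord2 n (z : 'rV[R]_n) (i j : 'I_n) : i != j ->
  (z ord0 i - z ord0 j) / Num.sqrt 2 <= enorm2 z.
Proof.
move=> ij; have s2 : 0 < Num.sqrt (2 : R) by rewrite sqrtr_gt0.
rewrite ler_pdivrMr// /enorm2 -sqrtrM; last by apply: sumr_ge0 => k _; exact: sqr_ge0.
apply: (le_trans (ler_norm _)); rewrite -sqrtr_sqr ler_wsqrtr//.
rewrite (bigD1 i)//= (bigD1 j)/=; last by rewrite eq_sym.
set S := \sum_(_ < _ | _) _; have S0 : 0 <= S by apply: sumr_ge0 => k _; exact: sqr_ge0.
set x := z _ i; set y := z _ j.
have := sqr_ge0 (x + y); nra.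
Qed.

(** The two cuts x_0 - x_1 > theta and x_1 - x_0 > theta, in corner coordinates.
Two free coordinates are needed besides the dependent one, hence n >= 3. *)
Lemma max_dist_ge m (theta : R) : 0 < theta -> theta < 1 ->
  ((Num.sqrt 2 * (omega R m.+3 * theta))%:E <=
   max_dist m.+3 (2^-1 * (1 - theta) ^+ m.+2))%E.
Proof.
move=> th0 th1; set w := omega R m.+3; set eps := _ * _ ^+ _.
have w0 : 0 < w by exact: omega_gt0.
pose D := [set t : m.+2.-tuple RR | corner m.+2 1 t /\
    theta < (thead t : R) - (thead (behead_tuple t) : R)].
pose D' := @swap2 R m @^-1` D.
have mD : measurable D.
  apply: measurableI; first exact: measurable_corner.
  have mf : measurable_fun setT (fun t : m.+2.-tuple RR =>
      (thead t : R) - (thead (behead_tuple t) : R)).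
    apply: measurable_funB; first exact: measurable_thead.
    by apply: measurableT_comp; [exact: measurable_thead|exact: measurable_behead].
  suff : measurable ((fun t : m.+2.-tuple RR =>
      (thead t : R) - (thead (behead_tuple t) : R)) @^-1` `]theta, +oo[).
    by congr measurable; apply/seteqP; split => t /=; rewrite in_itv/= andbT.
  by rewrite -[X in measurable X]setTI; exact: mf.
have [msw ssw] := @scales_swap2 R m.
have mD' : measurable D' by rewrite -[X in measurable X]setTI; exact: msw.
have DE : (m.+2`!%:R%:E * lebT m.+2 D)%E = eps%:E.
  rewrite lebT_corner_half ?ltW// -EFinM; congr EFin.
  by rewrite /eps; field; rewrite pnatr_eq0 -lt0n fact_gt0.
have D'E : (m.+2`!%:R%:E * lebT m.+2 D')%E = eps%:E.
  by rewrite /D' ssw// mul1e.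
have D1 : D `<=` corner m.+2 1 by move=> t [].
have D'1 : D' `<=` corner m.+2 1.
  move=> t; have [x [p ->]] := tuple_cons_ex t; have [y [u ->]] := tuple_cons_ex p.
  rewrite /D' /D /swap2 /= !(theadE, behead_cons) => -[+ _].
  rewrite !corner_cons => -[y0 [x0 ut]]; split => //; split => //.
  by move: ut; rewrite addrAC.
apply: (@le_trans _ _ (dist [set w *: simplex_point t | t in D] [set w *: simplex_point t | t in D'])).
  apply: le_ereal_inf_tmp => _ [_ [t [_ Dt] <-] [_ [u D'u <-]] <-].
  rewrite lee_fin.
  pose i0 : 'I_m.+3 := widen_ord (leqnSn m.+2) ord0.
  pose i1 : 'I_m.+3 := widen_ord (leqnSn m.+2) (lift ord0 ord0).
  have i01 : i0 != i1 by [].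
  apply: le_trans (enorm2_ge_coord2 _ i01).
  rewrite ler_pdivlMr ?sqrtr_gt0// mulrAC -expr2 sqr_sqrtr//.
  rewrite -scalerBr [X in _ <= X - _]mxE [X in _ <= _ - X]mxE.
  rewrite [X in _ * X - _]mxE [X in _ - _ * X]mxE ![(- simplex_point u) _ _]mxE !simplex_point_lift.
  move: D'u Dt; have [x [p ->]] := tuple_cons_ex t; have [y [t' ->]] := tuple_cons_ex p.
  have [x' [p' ->]] := tuple_cons_ex u; have [y' [t'' ->]] := tuple_cons_ex p'.
  rewrite /D' /D /swap2 /= !(theadE, behead_cons) => -[_ h1] h2.
  rewrite !tnth0 !tnthS !tnth0 -mulrBr mulrCA ler_pM2l//.
  move: h1 h2; rewrite /=; lra.
have AD := @subsets_of_volume_image m.+2 D eps isT mD D1 DE.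
have AD' := @subsets_of_volume_image m.+2 D' eps isT mD' D'1 D'E.
by apply: ereal_sup_ubound; exists [set w *: simplex_point t | t in D] => //;
  exists [set w *: simplex_point t | t in D'].
Qed.

End volume.

(** * Asymptotics of the lower bound *)

Section lower.
Context {R : realType}.

Lemma limn_einf_ge (u : nat -> \bar R) (l : \bar R) :
  (\forall n \near \oo, l <= u n)%E -> (l <= limn_einf u)%E.
Proof.
move=> [N _ Nu]; rewrite limn_einf_lim; apply: lime_ge; first exact: is_cvg_einfs.
exists N => // n /= Nn; apply: le_ereal_inf_tmp => _ [k /= nk <-].
by apply: Nu => /=; exact: leq_trans nk.
Qed.

Lemma limn_esup_le (u : nat -> \bar R) (l : \bar R) :
  (\forall n \near \oo, u n <= l)%E -> (limn_esup u <= l)%E.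
Proof.
move=> [N _ Nu]; rewrite limn_esup_lim; apply: lime_le; first exact: is_cvg_esups.
exists N => // n /= Nn; apply: ge_ereal_sup => _ [k /= nk <-].
by apply: Nu => /=; exact: leq_trans nk.
Qed.

(** The term of order m in the exponential series at m is at most e^m. *)
Lemma fact_ge_pow (m : nat) : (m%:R / expR 1) ^+ m <= m`!%:R :> R.
Proof.
case: m => [|m]; first by rewrite expr0.
have := @expR_ge1Dxn R m.+1%:R m (ler0n _ _).
rewrite -[X in expR X]mulr1 expRM_natl => H.
rewrite expr_div_n ler_pdivrMr ?exprn_gt0 ?expR_gt0//.
have f0 : 0 < (m.+1`!%:R : R) by rewrite ltr0n fact_gt0.
by rewrite mulrC -ler_pdivrMr//; apply: le_trans H; rewrite lerDr.
Qed.

Lemma omega_ge m : (0 < m)%N ->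
  m%:R / expR 1 * (1 - (Num.sqrt m%:R)^-1) <= omega R m.+1.
Proof.
move=> m0; set s : R := Num.sqrt m%:R.
have s1 : 1 <= s by rewrite -[1]sqrtr1 ler_wsqrtr// ler1n.
have s0 : 0 < s by exact: lt_le_trans s1.
have d0 : 0 <= 1 - s^-1 by rewrite subr_ge0 invf_le1.
have sm : s ^+ 2 = m%:R by rewrite sqr_sqrtr.
rewrite -(@ler_pXn2r _ m) ?nnegrE//; last 2 first.
  by rewrite mulr_ge0// divr_ge0// expR_ge0.
  exact/ltW/omega_gt0.
have S0 : 0 < Num.sqrt (m.+1%:R : R) by rewrite sqrtr_gt0 ltr0n.
rewrite -(ler_pM2r S0) omega_pow//; apply: le_trans (fact_ge_pow m).
rewrite exprMn -mulrA ler_piMr ?exprn_ge0 ?divr_ge0 ?expR_ge0//.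
(* The factor (1 - s^-1)^m absorbs sqrt (m + 1) <= 1 + s <= exp s. *)
have h1 : (1 - s^-1) ^+ m <= expR (- s).
  have -> : - s = m%:R * (- s^-1) by rewrite -sm; field; rewrite lt0r_neq0.
  by rewrite expRM_natl lerXn2r ?nnegrE// ?expR_ge0//; exact: expR_ge1Dx.
have h2 : Num.sqrt m.+1%:R <= expR s.
  apply: le_trans (expR_ge1Dx s).
  rewrite -[leRHS]ger0_norm ?addr_ge0 ?(ltW s0)// -sqrtr_sqr ler_wsqrtr//.
  by rewrite -natr1 -sm; nra.
apply: (@le_trans _ _ (expR (- s) * expR s)); last by rewrite expRN mulVf ?lt0r_neq0 ?expR_gt0.
by apply: ler_pM => //; exact: exprn_ge0.
Qed.

(** With m = k + 2, the value theta = 1 - exp (- L / m) gives the volume eps,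
and m theta >= L / (1 + L / m) since exp x >= 1 + x. *)
Lemma max_dist_ge_explicit k (eps : R) (L := - ln (2 * eps)) :
  0 < eps -> eps < 1 / 2 ->
  ((Num.sqrt 2 / expR 1 * ((1 - (Num.sqrt k.+2%:R)^-1) *
     (L / (1 + L * k.+2%:R^-1))))%:E <= max_dist k.+3 eps)%E.
Proof.
move=> e0 e1; have e2 : 0 < 2 * eps by lra.
have L0 : 0 < L by rewrite /L oppr_gt0 ln_lt0// e2/=; lra.
set M : R := k.+2%:R; have M0 : 0 < M by rewrite ltr0n.
pose theta := 1 - expR (- (L / M)).
have LM0 : 0 < L / M by rewrite divr_gt0.
have th0 : 0 < theta by rewrite subr_gt0 expR_lt1 oppr_lt0.
have th1 : theta < 1 by rewrite ltrBlDr ltrDl expR_gt0.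
have epsE : eps = 2^-1 * (1 - theta) ^+ k.+2.
  rewrite /theta subKr -expRM_natl -/M (_ : M * _ = - L); last first.
    by field; rewrite lt0r_neq0.
  by rewrite /L opprK lnK ?posrE// mulrA mulVf// mul1r.
rewrite [in leRHS]epsE; apply: le_trans (max_dist_ge k th0 th1).
rewrite lee_fin -mulrA ler_wpM2l ?sqrtr_ge0//.
have sM1 : 1 <= Num.sqrt M by rewrite -[1]sqrtr1 ler_wsqrtr// ler1n.
have h : L / (1 + L / M) <= M * theta.
  rewrite /theta; have : expR (- (L / M)) <= (1 + L / M)^-1.
    by rewrite expRN lef_pV2 ?posrE ?expR_gt0 ?expR_ge1Dx// addr_gt0.
  have h1 : 0 < 1 + L / M by rewrite addr_gt0.
  move=> h2; apply: (@le_trans _ _ (M * (1 - (1 + L / M)^-1))).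
    rewrite le_eqVlt; apply/orP; left; apply/eqP; field.
    by rewrite !lt0r_neq0// addr_gt0.
  by apply: ler_wpM2l; [exact: ltW|exact: lerB].
have := @omega_ge k.+2 isT; rewrite -/M => hw.
have hh : 0 <= 1 - (Num.sqrt M)^-1 by rewrite subr_ge0 invf_le1// (lt_le_trans _ sM1).
apply: (@le_trans _ _ ((expR 1)^-1 * ((1 - (Num.sqrt M)^-1) * (M * theta)))).
  by rewrite ler_wpM2l ?invr_ge0 ?expR_ge0// ler_wpM2l.
apply: (@le_trans _ _ ((M / expR 1 * (1 - (Num.sqrt M)^-1)) * theta)).
  by rewrite le_eqVlt; apply/orP; left; apply/eqP; ring.
by rewrite ler_wpM2r// ltW.
Qed.

Lemma limn_einf_max_dist (eps : R) : 0 < eps -> eps < 1 / 2 ->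
  ((- (Num.sqrt 2 / expR 1) * ln (2 * eps))%:E
             <= limn_einf (fun n : nat => max_dist n eps))%E.
Proof.
move=> e0 e1; set L := - ln (2 * eps).
have cV : (k.+2%:R^-1 : R) @[k --> \oo] --> 0.
  have := @cvg_harmonic R; rewrite -(cvg_shiftS (@harmonic R)); apply: cvg_trans.
  exact: cvg_id.
have cS : (Num.sqrt k.+2%:R : R)^-1 @[k --> \oo] --> 0.
  rewrite (_ : (fun k => _) = (fun k => Num.sqrt (k.+2%:R^-1 : R))); last first.
    by apply/funext => k; rewrite sqrtrV.
  rewrite -[X in _ --> X]sqrtr0.
  by apply: (@cvg_comp _ _ _ (fun k => k.+2%:R^-1 : R) Num.sqrt _ _ _ cV); exact: sqrt_continuous.
pose c k : R := Num.sqrt 2 / expR 1 * ((1 - (Num.sqrt k.+2%:R)^-1) *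
     (L / (1 + L * k.+2%:R^-1))).
have cc : c k @[k --> \oo] --> Num.sqrt 2 / expR 1 * ((1 - 0) * (L / (1 + L * 0))).
  apply: cvgMl_tmp; apply: cvgM; first by apply: cvgB => //; exact: cvg_cst.
  apply: cvgMl_tmp; apply: cvgV; first by rewrite mulr0 addr0 oner_neq0.
  by apply: cvgD; [exact: cvg_cst|apply: cvgMl_tmp].
rewrite mulNr -mulrN -/L; apply/lee_addgt0Pr => d d0.
rewrite -leeBlDr//; apply: limn_einf_ge.
have : \forall k \near \oo, Num.sqrt 2 / expR 1 * L - d < c k.
  move: cc; rewrite subr0 mul1r mulr0 addr0 divr1 => /cvgrPdist_lt /(_ d d0).
  by apply: filterS => k; rewrite ltr_norml => /andP[_]; rewrite ltrBlDr ltrBlDl addrC.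
move=> [N _ Nc]; exists N.+3 => // -[|[|[|n]]]//= Nn.
apply: le_trans (max_dist_ge_explicit n e0 e1); rewrite -EFinB lee_fin.
exact/ltW/Nc.
Qed.

End lower.

(** * A two-function inequality on the half line *)

Section exponential_line.
Context {R : realType}.
Local Notation RR := (measurableTypeR R).
Local Notation leb := (@lebesgue_measure R).

(** The square root of the exponential density. In the variable
s = half_exp x of (0, 1), the measure of density [half_density] is Lebesgue
measure, and the exponential law has density 2 s. *)
Definition half_exp (x : R) : R := expR (- (2^-1 * x)).
Definition half_density (x : R) : R := if 0 < x then 2^-1 * half_exp x else 0.

Lemma half_exp_gt0 x : 0 < half_exp x. Proof. exact: expR_gt0. Qed.

Lemma half_exp_le1 x : 0 < x -> half_exp x <= 1.
Proof. by move=> x0; rewrite expR_le1 oppr_le0 mulr_ge0// ltW. Qed.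

Lemma half_density_ge0 x : 0 <= half_density x.
Proof. by rewrite /half_density; case: ifP => // _; rewrite mulr_ge0// ltW// half_exp_gt0. Qed.

Lemma measurable_half_exp : measurable_fun setT half_exp.
Proof. by do 2 apply: measurableT_comp => //; exact: measurable_funM. Qed.

Lemma measurable_half_density : measurable_fun setT half_density.
Proof.
apply: measurable_fun_ifT => //; first exact: measurable_fun_ltr.
by apply: measurable_funM => //; exact: measurable_half_exp.
Qed.

(** In the variable s = half_exp x, this says that a subset of [a, 1] has
Lebesgue measure at most 1 - a. *)
Lemma half_density_tail (a : R) (A : set R) : 0 <= a <= 1 ->
  measurable (A : set RR) -> (forall x, 0 < x -> A x -> a <= half_exp x) ->
  (\int[leb]_x (half_density x * \1_A x)%:E <= (1 - a)%:E)%E.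
Proof.
move=> /andP[a0 a1] mA Aa.
have mf : measurable_fun setT (fun x => (half_density x * \1_A x)%:E).
  by apply/measurable_EFinP; apply: measurable_funM => //; exact: measurable_half_density.
have mp : measurable_fun setT (fun x : R => (exponential_pdf 2^-1 x)%:E).
  by apply/measurable_EFinP; exact: measurable_exponential_pdf.
have hp x : half_density x <= exponential_pdf 2^-1 x.
  rewrite /half_density; case: ifPn => [x0|_]; last by apply: exponential_pdf_ge0.
  by rewrite (exponential_pdfE _ (ltW x0)) /half_exp mulNr.
have hA x : half_density x * \1_A x <= half_density x.
  by rewrite ler_piMr ?half_density_ge0// indicE lern1 leq_b1.
move: a0; rewrite le_eqVlt => /orP[/eqP <-|a0].
  rewrite subr0 -(@integral_exponential_pdf R 2^-1)//.
  apply: ge0_le_integral => //.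
  - by move=> x _; rewrite lee_fin mulr_ge0// half_density_ge0.
  - by move=> x _; rewrite lee_fin; apply: le_trans (hp x); exact: hA.
pose xi := - 2 * ln a.
have xi0 : 0 <= xi by rewrite /xi mulNr oppr_ge0 mulr_ge0_le0 ?ln_le0.
have aE : a = expR (- 2^-1 * xi).
  by rewrite /xi mulrA mulrNN mulVf// mul1r lnK.
apply: (@le_trans _ _ (\int[leb]_(x in `[0%R, xi]) (exponential_pdf 2^-1 x)%:E)%E).
  rewrite [leRHS]integral_mkcond; apply: ge0_le_integral => //.
  - by move=> x _; rewrite lee_fin mulr_ge0// half_density_ge0.
  - by apply/(measurable_restrictT _ _).1 => //; exact: measurable_funTS.
  move=> x _; rewrite patchE; case: ifPn => xx.
    by rewrite lee_fin; apply: le_trans (hp x); exact: hA.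
  rewrite lee_fin indicE /half_density; case: ifPn => [x0|_]; last by rewrite mul0r.
  case: (boolP (x \in A)) => xA; last by rewrite mulr0.
  exfalso; move/negP: xx; apply; rewrite inE/= in_itv/= ltW//=.
  have := Aa _ x0 (set_mem xA); rewrite {1}aE /half_exp ler_expR mulNr lerN2.
  by rewrite ler_pM2l.
move: xi0; rewrite le_eqVlt => /orP[/eqP xi0|xi0].
  rewrite -xi0 set_itv1 integral_set1 lee_fin subr_ge0 aE -xi0 mulr0 expR0//.
by rewrite -[leLHS]/(exponential_prob 2^-1 `[0%R, xi]) exponential_prob_itv0c// -aE.
Qed.

Lemma integral_id01 : (\int[leb]_(t in `]0%R, 1%R[) t%:E = (2^-1)%:E)%E.
Proof.
have h := @integral_pow_sub R 1 1 ltr01.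
have : (\int[leb]_(t in `]0%R, 1%R[) (t%:E + ((1 - t) ^+ 1 / 1`!%:R)%:E) = 1)%E.
  rewrite (eq_integral (cst 1%E)); last first.
    by move=> t _; rewrite -EFinD /= expr1 divr1 subrKC.
  have L : leb `]0%R, 1%R[%classic = 1%E.
    by rewrite lebesgue_measure_itv/= lte_fin ltr01 -EFinB subr0.
  by rewrite integral_cst// mul1e; exact: L.
rewrite ge0_integralD//=.
- rewrite h expr1n; case: (integral _ _ _) => [r| |]//.
  rewrite -EFinD => -[]; have -> : 2`!%:R = 2 :> R by [].
  by move=> hr; congr EFin; lra.
- by move=> t; rewrite in_itv/= lee_fin => /andP[/ltW].
- by move=> t; rewrite in_itv/= lee_fin expr1 divr1 subr_ge0 => /andP[_ /ltW].
- apply/measurable_EFinP; apply: measurable_funM => //.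
  by apply: measurable_funX; exact: measurable_funB.
Qed.

(** Tonelli on the region below the graph of F. *)
Lemma layer_cake (F : R -> R) : measurable_fun setT F -> (forall x, 0 <= F x <= 1) ->
  (\int[leb]_x (half_density x * F x)%:E =
   \int[leb]_(t in `]0%R, 1%R[) \int[leb]_x (half_density x * \1_[set y | t < F y] x)%:E)%E.
Proof.
move=> mF F01.
pose k (p : RR * RR) : \bar R :=
  (half_density p.1 * \1_[set p : RR * RR | (0 < (p.2 : R)) && ((p.2 : R) < F p.1)] p)%:E.
have mk : measurable_fun setT k.
  apply/measurable_EFinP; apply: measurable_funM.
    by apply: measurableT_comp; [exact: measurable_half_density|exact: measurable_fst].
  apply: measurable_indic.
  have m1 : measurable_fun setT (fun p : RR * RR => (0 < (p.2 : R)) && ((p.2 : R) < F p.1)).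
    apply: measurable_and; apply: measurable_fun_ltr => //.
    by apply: measurableT_comp.
  rewrite (_ : mkset _ = (fun p : RR * RR => (0 < (p.2 : R)) && ((p.2 : R) < F p.1)) @^-1` [set true]).
    by rewrite -[X in measurable X]setTI; exact: m1.
  by apply/seteqP; split => p /=.
have k0 p : (0 <= k p)%E by rewrite lee_fin mulr_ge0// half_density_ge0.
have := @fubini_tonelli _ _ _ _ _ leb leb k mk k0 => tonelli.
transitivity (\int[leb]_x \int[leb]_t k (x, t))%E.
  apply: eq_integral => x _.
  transitivity (\int[leb]_t ((half_density x)%:E * (\1_(`]0%R, F x[%classic) t)%:E))%E.
    rewrite ge0_integralZl//.
    - have L : leb `]0%R, F x[%classic = (F x)%:E.
        rewrite lebesgue_measure_itv/= lte_fin.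
        have /andP[Fx0 _] := F01 x; move: Fx0; rewrite le_eqVlt => /orP[/eqP <-|Fx0].
          by rewrite ltxx.
        by rewrite Fx0 -EFinB subr0.
      by rewrite integral_indic// setIT [X in (_ * X)%E]L -EFinM.
    - exact/measurable_EFinP.
    - by rewrite lee_fin half_density_ge0.
  apply: eq_integral => t _; rewrite -EFinM; congr (_ * _)%:E.
rewrite tonelli [RHS]integral_mkcond; apply: eq_integral => t _.
rewrite patchE; case: ifPn => [|/negP tN].
  rewrite inE/= in_itv/= => /andP[t0 t1].
  apply: eq_integral => x _; congr (_ * _)%:E.
  rewrite !indicE; congr (nat_of_bool _)%:R.
  by apply/idP/idP; rewrite !inE/= t0.
apply: integral0_eq => x _; rewrite /k indicE.
case: (boolP (_ \in _)) => [|_]; last by rewrite mulr0.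
rewrite inE/= => /andP[t0 tF]; exfalso; apply: tN.
rewrite inE/= in_itv/= t0/=; apply: lt_le_trans tF _.
by have /andP[] := F01 x.
Qed.

Lemma measurable_level_integral (F : R -> R) : measurable_fun setT F ->
  measurable_fun setT (fun t : RR =>
    \int[leb]_x (half_density x * \1_[set y | (t : R) < F y] x)%:E)%E.
Proof.
move=> mF.
pose k (p : RR * RR) : \bar R :=
  (half_density p.1 * \1_[set p : RR * RR | (p.2 : R) < F p.1] p)%:E.
have mk : measurable_fun setT k.
  apply/measurable_EFinP; apply: measurable_funM.
    by apply: measurableT_comp; [exact: measurable_half_density|exact: measurable_fst].
  apply: measurable_indic.
  have m1 : measurable_fun setT (fun p : RR * RR => (p.2 : R) < F p.1).
    by apply: measurable_fun_ltr => //; apply: measurableT_comp.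
  rewrite (_ : mkset _ = (fun p : RR * RR => (p.2 : R) < F p.1) @^-1` [set true]).
    by rewrite -[X in measurable X]setTI; exact: m1.
  by apply/seteqP; split => p /=.
have k0 p : (0 <= k p)%E by rewrite lee_fin mulr_ge0// half_density_ge0.
have := @measurable_fun_fubini_tonelli_G _ _ RR RR R leb k mk k0.
congr measurable_fun; apply/funext => t; apply: eq_integral => x _ /=.
Qed.

(** For t < 1, let a and b be the infima of half_exp on the nonempty level sets
F > t and G > t. The last hypothesis gives a + b >= q t, while the level sets
have measures at most 1 - a and 1 - b. Integrating
(1 - a) + (1 - b) <= 2 - q t over t in (0, 1) gives the bound. This is the proof of the
Prekopa-Leindler inequality on the line, where the level sets of the function
that bounds sqrt (F G) are here intervals with endpoint 1. *)
Lemma half_density_two_function (F G : R -> R) (q : R) : 0 < q ->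
  measurable_fun setT F -> measurable_fun setT G ->
  (forall x, 0 <= F x <= 1) -> (forall x, 0 <= G x <= 1) ->
  (forall t, t < 1 -> exists2 x, 0 < x & t < F x) ->
  (forall t, t < 1 -> exists2 x, 0 < x & t < G x) ->
  (forall x y, 0 < x -> 0 < y ->
     q ^+ 2 * (F x * G y) <= (half_exp x + half_exp y) ^+ 2) ->
  (\int[leb]_x (half_density x * F x)%:E + \int[leb]_x (half_density x * G x)%:E
    <= (2 - q / 2)%:E)%E.
Proof.
move=> q0 mF mG F01 G01 Fs Gs FG.
have mL (H : R -> R) : measurable_fun setT H -> measurable_fun (`]0, 1[%classic : set RR)
    (fun t : R => \int[leb]_x (half_density x * \1_[set y | t < H y] x)%:E)%E.
  by move=> mH; exact: measurable_funTS (measurable_level_integral mH).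
have L0 (H : R -> R) (t : R) : (0 <=
    \int[leb]_x (half_density x * \1_[set y | (t < H y)%R] x)%:E)%E.
  by apply: integral_ge0 => x _; rewrite lee_fin mulr_ge0// half_density_ge0.
(* Moving q / 2, the integral of q t, to the left makes all the integrands
   nonnegative. *)
rewrite !layer_cake// -ge0_integralD//; [|exact: mL|exact: mL].
rewrite EFinB leeBrDr//.
have -> : (q / 2)%:E = (\int[leb]_(t in `]0%R, 1%R[) (q%:E * t%:E))%E.
  rewrite ge0_integralZl//.
  - by rewrite integral_id01 -EFinM.
  - by move=> t /=; rewrite in_itv/= lee_fin => /andP[/ltW].
  - by rewrite lee_fin ltW.
rewrite -ge0_integralD//; last 4 first.
- by move=> t _; exact: adde_ge0.
- by apply: emeasurable_funD; exact: mL.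
- by move=> t /=; rewrite in_itv/= => /andP[/ltW t0 _]; rewrite -EFinM lee_fin mulr_ge0// ltW.
- by apply/measurable_EFinP; exact: measurable_funM.
apply: (@le_trans _ _ (\int[leb]_(t in `]0%R, 1%R[) (cst 2%:E t))%E); last first.
  have L : leb `]0%R, 1%R[%classic = 1%E.
    by rewrite lebesgue_measure_itv/= lte_fin ltr01 -EFinB subr0.
  by rewrite integral_cst// [X in (_ * X)%E]L mule1.
apply: ge0_le_integral => //.
- move=> t /=; rewrite in_itv/= => /andP[/ltW t0 _].
  apply: adde_ge0; first exact: adde_ge0.
  by rewrite -EFinM lee_fin mulr_ge0// ltW.
- apply: emeasurable_funD; first by apply: emeasurable_funD; exact: mL.
  by apply/measurable_EFinP; exact: measurable_funM.
move=> t /=; rewrite in_itv/= => /andP[t0 t1].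
pose SF := [set half_exp x | x in [set x | 0 < x /\ t < F x]].
pose SG := [set half_exp x | x in [set x | 0 < x /\ t < G x]].
have SF0 : SF !=set0 by have [x x0 tx] := Fs t t1; exists (half_exp x), x.
have SG0 : SG !=set0 by have [x x0 tx] := Gs t t1; exists (half_exp x), x.
have hF : has_inf SF by split => //; exists 0 => _ [x _ <-]; exact/ltW/half_exp_gt0.
have hG : has_inf SG by split => //; exists 0 => _ [x _ <-]; exact/ltW/half_exp_gt0.
set a := inf SF; set b := inf SG.
have sumab : q * t <= a + b.
  rewrite -lerBlDr; apply: lb_le_inf => // _ [x [x0 tx] <-].
  rewrite lerBlDr -lerBlDl; apply: lb_le_inf => // _ [y [y0 ty] <-].
  rewrite lerBlDl -(@ler_pXn2r _ 2) ?nnegrE//; last 2 first.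
  - by rewrite mulr_ge0 ?(ltW q0)// ltW.
  - by rewrite addr_ge0// ltW// half_exp_gt0.
  apply: le_trans (FG x y x0 y0); rewrite exprMn ler_wpM2l ?sqr_ge0// expr2.
  by apply: ler_pM; exact: ltW.
have inf01 (S : set R) (H : R -> R) : S = [set half_exp x | x in [set x | 0 < x /\ t < H x]] ->
    has_inf S -> 0 <= inf S <= 1.
  move=> -> hS; apply/andP; split.
    by apply: lb_le_inf; [exact: hS.1|move=> _ [x _ <-]; exact/ltW/half_exp_gt0].
  have [_ [x [x0 tx] _]] := hS.1.
  apply: (@le_trans _ _ (half_exp x)); last exact: half_exp_le1.
  by apply: ge_inf; [exact: hS.2|exists x].
have mS (H : R -> R) : measurable_fun setT H -> measurable ([set y | t < H y] : set RR).
  move=> mH; rewrite (_ : mkset _ = H @^-1` `]t, +oo[).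
    by rewrite -[X in measurable X]setTI; exact: mH.
  by apply/seteqP; split => y /=; rewrite in_itv/= andbT.
have HF := @half_density_tail a _ (inf01 _ _ erefl hF) (mS _ mF).
have HG := @half_density_tail b _ (inf01 _ _ erefl hG) (mS _ mG).
apply: (@le_trans _ _ ((1 - a)%:E + (1 - b)%:E + (q * t)%:E)%E).
  rewrite -EFinM; apply: leeD => //; apply: leeD.
    by apply: HF => x x0 /= tx; apply: ge_inf; [exact: hF.2|exists x].
  by apply: HG => x x0 /= tx; apply: ge_inf; [exact: hG.2|exists x].
rewrite -!EFinD lee_fin; lra.
Qed.

End exponential_line.

Section two_function.
Context {R : realType}.
Local Notation RR := (measurableTypeR R).
Local Notation leb := (@lebesgue_measure R).

Definition exp_weight (x : R) : R := if 0 < x then expR (- x) else 0.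

(** cosh^2 ((x - y) / 4), see [kappaE]. *)
Definition kappa (x y : R) : R :=
  (half_exp x + half_exp y) ^+ 2 / (4 * (half_exp x * half_exp y)).

Lemma kappa_gt0 x y : 0 < kappa x y.
Proof.
by rewrite divr_gt0 ?exprn_gt0 ?addr_gt0 ?mulr_gt0 ?half_exp_gt0.
Qed.

Lemma exp_weight_ge0 x : 0 <= exp_weight x.
Proof. by rewrite /exp_weight; case: ifP => // _; exact: expR_ge0. Qed.

Lemma half_exp_sqr (x : R) : half_exp x ^+ 2 = expR (- x).
Proof. by rewrite expr2 -expRD; congr (@expR R _); field. Qed.

Lemma measurable_exp_weight : measurable_fun setT exp_weight.
Proof.
apply: measurable_fun_ifT => //; first exact: measurable_fun_ltr.
by apply: measurableT_comp.
Qed.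

(** The functions 2 f half_exp and 2 g half_exp, divided by their suprema P and
Q, satisfy the hypotheses of [half_density_two_function] with q = sqrt (P Q). By
the inequality between arithmetic and geometric means, the product of the two
integrals is at most (q (1 - q / 4))^2, and q (1 - q / 4) <= 1. *)
Lemma exp_two_function_real (f g : R -> R) (M : R) :
  measurable_fun setT f -> measurable_fun setT g ->
  (forall x, 0 <= f x <= M) -> (forall x, 0 <= g x <= M) ->
  (forall x y, 0 < x -> 0 < y -> f x * g y <= kappa x y) ->
  (\int[leb]_x (exp_weight x * f x)%:E * \int[leb]_x (exp_weight x * g x)%:E <= 1)%E.
Proof.
move=> mf mg fM gM fg.
have M0 : 0 <= M by have /andP[] := fM 0; exact: le_trans.
pose lift (f : R -> R) x := if 0 < x then 2 * (f x * half_exp x) else 0.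
have mlift (h : R -> R) : measurable_fun setT h -> measurable_fun setT (lift h).
  move=> mh; apply: measurable_fun_ifT => //; first exact: measurable_fun_ltr.
  by apply: measurable_funM => //; apply: measurable_funM => //; exact: measurable_half_exp.
have lift_ge0 (h : R -> R) x : (forall x, 0 <= h x <= M) -> 0 <= lift h x.
  move=> hM; rewrite /lift; case: ifP => // _; have /andP[h0 _] := hM x.
  by rewrite !mulr_ge0// ltW// half_exp_gt0.
have lift_le (h : R -> R) x : (forall x, 0 <= h x <= M) -> lift h x <= 2 * M.
  move=> hM; rewrite /lift; case: ifPn => [x0|_]; last by rewrite mulr_ge0.
  have /andP[h0 h1] := hM x; rewrite ler_wpM2l//.
  by rewrite -[M]mulr1 ler_pM// ?half_exp_le1// ltW// half_exp_gt0.
have wE (h : R -> R) x : exp_weight x * h x = half_density x * lift h x.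
  rewrite /exp_weight /half_density /lift; case: ifP => _; last by rewrite !mul0r.
  by rewrite -half_exp_sqr; field.
have hs (h : R -> R) : (forall x, 0 <= h x <= M) -> has_sup (range (lift h)).
  move=> hM; split; first by exists (lift h 0), 0.
  by exists (2 * M) => _ [x _ <-]; exact: lift_le.
pose P := sup (range (lift f)); pose Q := sup (range (lift g)).
have zero (h : R -> R) : (forall x, 0 <= h x <= M) -> sup (range (lift h)) <= 0 ->
    (\int[leb]_x (exp_weight x * h x)%:E = 0)%E.
  move=> hM h0; apply: integral0_eq => x _; rewrite wE.
  suff -> : lift h x = 0 by rewrite mulr0.
  apply/eqP; rewrite eq_le lift_ge0// andbT; apply: le_trans h0.
  by apply: ub_le_sup; [exact: (hs _ hM).2|exists x].
have [P0|P0] := leP P 0; first by rewrite (zero f)// mul0e lee01.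
have [Q0|Q0] := leP Q 0; first by rewrite (zero g)// mule0 lee01.
have near (h : R -> R) : (forall x, 0 <= h x <= M) -> 0 < sup (range (lift h)) ->
    forall t, t < 1 -> exists2 x, 0 < x & t < lift h x / sup (range (lift h)).
  move=> hM s0 t t1; set s := sup _ in s0 *.
  pose t' := Num.max t 0.
  have t'1 : t' < 1 by rewrite gt_max t1 ltr01.
  have : 0 < (1 - t') * s by rewrite mulr_gt0// subr_gt0.
  move=> /(sup_adherent)/(_ (hs _ hM)) [_ [x _ <-]]; rewrite -/s.
  rewrite mulrBl mul1r subKr => tx; exists x.
    have : 0 < lift h x by apply: le_lt_trans tx; rewrite mulr_ge0 ?(ltW s0)// le_max lexx orbT.
    by rewrite /lift; case: ifP => //; rewrite ltxx.
  rewrite ltr_pdivlMr//; apply: le_lt_trans tx.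
  by rewrite ler_pM2r// le_max lexx.
have norm01 (h : R -> R) : (forall x, 0 <= h x <= M) -> 0 < sup (range (lift h)) ->
    forall x, 0 <= lift h x / sup (range (lift h)) <= 1.
  move=> hM s0 x; rewrite divr_ge0 ?lift_ge0 ?(ltW s0)//= ler_pdivrMr// mul1r.
  by apply: ub_le_sup; [exact: (hs _ hM).2|exists x].
pose q := Num.sqrt (P * Q).
have q2 : q ^+ 2 = P * Q by rewrite sqr_sqrtr// mulr_ge0// ltW.
have q0 : 0 < q by rewrite sqrtr_gt0 mulr_gt0.
have mlP (h : R -> R) (c : R) : measurable_fun setT h ->
    measurable_fun setT (fun x => lift h x / c).
  by move=> mh; apply: measurable_funM => //; exact: mlift.
have main := half_density_two_function q0 (mlP f P mf) (mlP g Q mg)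
  (norm01 _ fM P0) (norm01 _ gM Q0) (near _ fM P0) (near _ gM Q0).
have scale (h : R -> R) (c : R) : measurable_fun setT h -> (forall x, 0 <= h x <= M) ->
    0 < c -> (\int[leb]_x (exp_weight x * h x)%:E =
    c%:E * \int[leb]_x (half_density x * (lift h x / c))%:E)%E.
  move=> mh hM c0; rewrite -ge0_integralZl//.
  - apply: eq_integral => x _; rewrite -EFinM wE; congr EFin.
    by field; rewrite lt0r_neq0.
  - apply/measurable_EFinP; apply: measurable_funM; last exact: mlP.
    exact: measurable_half_density.
  - by move=> x _; rewrite lee_fin mulr_ge0 ?half_density_ge0// divr_ge0 ?lift_ge0// ltW.
  - by rewrite lee_fin ltW.
rewrite (scale f P)// (scale g Q)//.
have {main} : (\int[leb]_x (half_density x * (lift f x / P))%:E +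
   \int[leb]_x (half_density x * (lift g x / Q))%:E <= (2 - q / 2)%:E)%E.
  apply: main => x y x0 y0; rewrite q2 /lift x0 y0.
  have := fg x y x0 y0; rewrite /kappa ler_pdivlMr ?mulr_gt0 ?half_exp_gt0//.
  apply: le_trans; rewrite le_eqVlt; apply/orP; left; apply/eqP; field.
  by rewrite !lt0r_neq0.
have I0 (h : R -> R) (c : R) : (forall x, 0 <= h x <= M) -> 0 < c ->
    (0 <= \int[leb]_x (half_density x * (lift h x / c))%:E)%E.
  move=> hM c0; apply: integral_ge0 => x _.
  by rewrite lee_fin mulr_ge0 ?half_density_ge0// divr_ge0 ?lift_ge0// ltW.
have := I0 f P fM P0; have := I0 g Q gM Q0.
case: (integral _ _ _) => [b| |]//; case: (integral _ _ _) => [a| |]//.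
rewrite -EFinD -!EFinM !lee_fin => b0 a0 ab.
have h1 : P * a * (Q * b) = q ^+ 2 * (a * b) by rewrite q2; ring.
rewrite h1.
have h2 : 4 * (a * b) <= (2 - q / 2) ^+ 2.
  have : (a + b) ^+ 2 <= (2 - q / 2) ^+ 2 by rewrite ler_pXn2r// nnegrE; lra.
  by apply: le_trans; have := sqr_ge0 (a - b); nra.
have h3 : q * (2 - q / 2) <= 2 by have := sqr_ge0 (q - 2); nra.
have h4 : 0 <= q * (2 - q / 2) by rewrite mulr_ge0// ?(ltW q0)//; lra.
have h5 : (q * (2 - q / 2)) ^+ 2 <= 4.
  have -> : (4 : R) = 2 ^+ 2 by ring.
  by rewrite ler_pXn2r// nnegrE.
rewrite exprMn in h5.
have : q ^+ 2 * (4 * (a * b)) <= 4.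
  by apply: le_trans h5; rewrite ler_wpM2l// sqr_ge0.
lra.
Qed.

End two_function.

(** * Products of the exponential law *)

Section tensor.
Context {R : realType}.
Local Notation RR := (measurableTypeR R).
Local Notation leb := (@lebesgue_measure R).

(** The density of m independent standard exponential variables. *)
Definition exp_weightT m (t : m.-tuple RR) : R := \prod_(i < m) exp_weight (tnth t i).

Definition kappaT m (s t : m.-tuple RR) : R :=
  \prod_(i < m) kappa (tnth s i) (tnth t i).

(** The expectation of u(X), where the coordinates of X are independent standard
exponential variables. *)
Definition expectT m (u : m.-tuple RR -> \bar R) : \bar R :=
  (\int[lebT m]_t ((exp_weightT t)%:E * u t))%E.

Lemma prod_cons m (F : R -> R) (x : RR) (t : m.-tuple RR) :
  \prod_(i < m.+1) F (tnth (cons_tuple x t) i) = F x * \prod_(i < m) F (tnth t i).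
Proof.
rewrite big_ord_recl tnth0; congr (_ * _).
by apply: eq_bigr => i _; rewrite tnthS.
Qed.

Lemma kappaT_cons m (x y : RR) (s t : m.-tuple RR) :
  kappaT (cons_tuple x s) (cons_tuple y t) = kappa x y * kappaT s t.
Proof.
rewrite /kappaT big_ord_recl !tnth0; congr (_ * _).
by apply: eq_bigr => i _; rewrite !tnthS.
Qed.

Lemma exp_weightT_ge0 m (t : m.-tuple RR) : 0 <= exp_weightT t.
Proof. by apply: prodr_ge0 => i _; exact: exp_weight_ge0. Qed.

Lemma measurable_exp_weightT m : measurable_fun setT (@exp_weightT m).
Proof.
apply: measurable_prod => i _.
by apply: measurableT_comp; [exact: measurable_exp_weight|exact: measurable_tnth].
Qed.

Section expectT.
Variable m : nat.
Implicit Types u v : m.-tuple RR -> \bar R.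
Local Open Scope ereal_scope.

Lemma measurable_weighted u : measurable_fun setT u ->
  measurable_fun setT (fun t => (exp_weightT t)%:E * u t).
Proof.
move=> mu; apply: emeasurable_funM => //; apply/measurable_EFinP.
exact: measurable_exp_weightT.
Qed.

Lemma weighted_ge0 u : (forall t, 0 <= u t) -> forall t, 0 <= (exp_weightT t)%:E * u t.
Proof. by move=> u0 t; rewrite mule_ge0// lee_fin exp_weightT_ge0. Qed.

Lemma expectT_ge0 u : (forall t, 0 <= u t) -> 0 <= expectT u.
Proof. by move=> u0; apply: integral_ge0 => t _; exact: weighted_ge0. Qed.

Lemma expectTZ u (c : R) : measurable_fun setT u -> (forall t, 0 <= u t) ->
  (0 <= c)%R -> expectT (fun t => c%:E * u t) = c%:E * expectT u.
Proof.
move=> mu u0 c0; rewrite /expectT -ge0_integralZl//.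
- by apply: eq_integral => t _; rewrite muleCA.
- exact: measurable_weighted.
- by move=> t _; exact: weighted_ge0.
Qed.

Lemma expectTD u v : measurable_fun setT u -> measurable_fun setT v ->
  (forall t, 0 <= u t) -> (forall t, 0 <= v t) ->
  expectT (fun t => u t + v t) = expectT u + expectT v.
Proof.
move=> mu mv u0 v0; rewrite /expectT -ge0_integralD//.
- by apply: eq_integral => t _; rewrite ge0_muleDr.
- by move=> t _; exact: weighted_ge0.
- exact: measurable_weighted.
- by move=> t _; exact: weighted_ge0.
- exact: measurable_weighted.
Qed.

End expectT.

Lemma exp_weightT_pos m (t : m.-tuple RR) :
  (forall i, 0 < (tnth t i : R)) \/ exp_weightT t = 0.
Proof.
have [/forallP h|] := boolP [forall i, 0 < (tnth t i : R)]; [by left|].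
rewrite negb_forall => /existsP[i ti]; right.
by rewrite /exp_weightT (bigD1 i)//= /exp_weight (negbTE ti) mul0r.
Qed.

(** The density vanishes at the points with a nonpositive coordinate. *)
Lemma le_expectT m (u v : m.-tuple RR -> \bar R) :
  measurable_fun setT u -> measurable_fun setT v ->
  (forall t, 0 <= u t)%E ->
  (forall t, (forall i, 0 < (tnth t i : R)) -> (u t <= v t)%E) ->
  (expectT u <= expectT v)%E.
Proof.
move=> mu mv u0 uv; apply: ge0_le_integral => //.
- by move=> t _; exact: weighted_ge0.
- exact: measurable_weighted.
- exact: measurable_weighted.
move=> t _; have [tp|->] := exp_weightT_pos t; last by rewrite !mul0e.
by rewrite lee_wpmul2l ?lee_fin ?exp_weightT_ge0// uv.
Qed.

Section cons.
Variables (m : nat) (u : m.+1.-tuple RR -> \bar R).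
Hypotheses (mu : measurable_fun setT u) (u0 : forall t, (0 <= u t)%E).
Local Open Scope ereal_scope.

Lemma measurable_fun_cons (x : RR) :
  measurable_fun setT (fun t : m.-tuple RR => u (cons_tuple x t)).
Proof.
apply: measurableT_comp => //.
exact: (measurable_cons (measurable_cst x) (@measurable_id _ _ setT)).
Qed.

Lemma measurable_expectT_cons :
  measurable_fun setT (fun x : RR => expectT (fun t => u (cons_tuple x t))).
Proof.
pose k (p : RR * m.-tuple RR) := (exp_weightT p.2)%:E * u (cons_tuple p.1 p.2).
have mk : measurable_fun setT k.
  apply: emeasurable_funM; last exact: (measurableT_comp mu measurable_cons_pair).
  apply/measurable_EFinP; apply: measurableT_comp => //.
  exact: measurable_exp_weightT.
apply: (@measurable_fun_fubini_tonelli_F _ _ RR (m.-tuple RR) R (lebT m) k mk).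
by move=> p; rewrite mule_ge0// lee_fin exp_weightT_ge0.
Qed.

Lemma expectT_cons : expectT u =
  \int[leb]_x ((exp_weight x)%:E * expectT (fun t => u (cons_tuple x t))).
Proof.
rewrite /expectT integral_cons_measure; last 2 first.
- exact: measurable_weighted.
- exact: weighted_ge0.
apply: eq_integral => x _; rewrite -ge0_integralZl//; last 3 first.
- by apply: measurable_weighted; exact: measurable_fun_cons.
- by move=> t _; apply: mule_ge0 => //; rewrite lee_fin exp_weightT_ge0.
- by rewrite lee_fin exp_weight_ge0.
by apply: eq_integral => t _; rewrite /exp_weightT prod_cons EFinM muleA.
Qed.

End cons.

Lemma expectT0 (u : 0.-tuple RR -> \bar R) : measurable_fun setT u ->
  expectT u = u [tuple].
Proof.
move=> mu; rewrite /expectT /= integral_dirac//; last exact: measurable_weighted.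
by rewrite diracT mul1e /exp_weightT big_ord0 mul1e.
Qed.

Lemma expectT_prod m (phi : R -> R) (c : R) : measurable_fun setT phi ->
  (forall x, 0 <= phi x) ->
  (\int[leb]_x (exp_weight x * phi x)%:E = c%:E)%E ->
  expectT (fun t : m.-tuple RR => (\prod_(i < m) phi (tnth t i))%:E) = (c ^+ m)%:E.
Proof.
move=> mphi phi0 hc.
have c0 : 0 <= c.
  rewrite -lee_fin -hc; apply: integral_ge0 => x _.
  by rewrite lee_fin mulr_ge0 ?exp_weight_ge0.
have mp k : measurable_fun setT (fun t : k.-tuple RR => (\prod_(i < k) phi (tnth t i))%:E).
  apply/measurable_EFinP; apply: measurable_prod => i _.
  by apply: measurableT_comp => //; exact: measurable_tnth.
have p0 k (t : k.-tuple RR) : (0 <= (\prod_(i < k) phi (tnth t i))%:E)%E.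
  by rewrite lee_fin; apply: prodr_ge0.
elim: m => [|m ih].
  by rewrite expectT0// big_ord0.
rewrite expectT_cons// exprS EFinM -hc.
rewrite -ge0_integralZr//; last 3 first.
- by apply/measurable_EFinP; apply: measurable_funM => //; exact: measurable_exp_weight.
- by move=> x _; rewrite lee_fin mulr_ge0 ?exp_weight_ge0.
- by rewrite lee_fin exprn_ge0.
apply: eq_integral => x _.
under [in LHS]eq_fun do rewrite prod_cons EFinM.
by rewrite expectTZ// ih EFinM muleA.
Qed.

Lemma integral_exp_weight (k : R) : 0 < k ->
  (\int[leb]_x (exp_weight x * expR ((1 - k) * x))%:E = (k^-1)%:E)%E.
Proof.
move=> k0.
have hpdf : (\int[leb]_x (exponential_pdf k x)%:E = 1)%E by exact: integral_exponential_pdf.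
have mp : measurable_fun setT (fun x : R => (exponential_pdf k x)%:E).
  by apply/measurable_EFinP; exact: measurable_exponential_pdf.
rewrite -[RHS]mule1 -hpdf -ge0_integralZl//; last 2 first.
- by move=> x _; rewrite lee_fin exponential_pdf_ge0// ltW.
- by rewrite lee_fin invr_ge0 ltW.
(* The two integrands differ only at 0. *)
apply: ae_eq_integral => //.
- apply/measurable_EFinP; apply: measurable_funM; first exact: measurable_exp_weight.
  by apply: measurableT_comp => //; exact: measurable_funM.
- by apply: emeasurable_funM.
exists [set 0]; split => //; first exact: lebesgue_measure_set1.
move=> x /=; apply: contra_notP => /eqP x0 _.
rewrite -EFinM /exp_weight; move: x0; rewrite neq_lt => /orP[x0|x0].
  by rewrite ltNge (ltW x0)/= mul0r lt0_exponential_pdf// mulr0.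
rewrite x0 (exponential_pdfE _ (ltW x0)) -expRD mulrA mulVf ?lt0r_neq0// mul1r.
by congr (expR _)%:E; ring.
Qed.

Lemma expectT1 m : expectT (fun _ : m.-tuple RR => 1%E) = 1%E.
Proof.
rewrite -[RHS](congr1 EFin (expr1n R m)).
rewrite -(@expectT_prod m (fun=> 1) 1 (measurable_cst _) (fun _ => ler01)).
  by congr expectT; apply/funext => t; rewrite big1.
rewrite -[in RHS]invr1 -(integral_exp_weight ltr01).
by apply: eq_integral => x _; rewrite subrr mul0r expR0.
Qed.

(** Fix the first coordinates x and y. The induction hypothesis, applied to
u / kappa x y and v, bounds the product of the two conditional expectations by
kappa x y; the one-dimensional inequality then applies to these expectations. The
bound M makes them finite. *)
Theorem two_function m (u v : m.-tuple RR -> \bar R) (M : R) :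
  measurable_fun setT u -> measurable_fun setT v ->
  (forall t, 0 <= u t <= M%:E)%E -> (forall t, 0 <= v t <= M%:E)%E ->
  (forall s t, (forall i, 0 < (tnth s i : R)) -> (forall i, 0 < (tnth t i : R)) ->
    (u s * v t <= (kappaT s t)%:E)%E) ->
  (expectT u * expectT v <= 1)%E.
Proof.
elim: m u v M => [|m ih] u v M mu mv uM vM uv.
  rewrite !expectT0//; apply: le_trans (uv _ _ _ _) _; [by case|by case|].
  by rewrite /kappaT big_ord0.
have u0 t : (0 <= u t)%E by have /andP[] := uM t.
have v0 t : (0 <= v t)%E by have /andP[] := vM t.
have M0 : 0 <= M.
  by rewrite -lee_fin; have /andP[] := uM (nseq_tuple m.+1 (0 : R)); exact: le_trans.
have bound (w : m.+1.-tuple RR -> \bar R) x : measurable_fun setT w ->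
    (forall t, 0 <= w t <= M%:E)%E ->
    (0 <= expectT (fun t => w (cons_tuple x t)) <= M%:E)%E.
  move=> mw wM; apply/andP; split.
    by apply: expectT_ge0 => t; have /andP[] := wM (cons_tuple x t).
  rewrite -[leRHS]mule1 -(expectT1 m) -expectTZ//.
  apply: le_expectT; [exact: measurable_fun_cons| | |].
  - by under eq_fun do rewrite mule1; exact: measurable_cst.
  - by move=> t; have /andP[] := wM (cons_tuple x t).
  - by move=> t _; rewrite mule1; have /andP[] := wM (cons_tuple x t).
pose E (w : m.+1.-tuple RR -> \bar R) x := expectT (fun t => w (cons_tuple x t)).
have fin w x : measurable_fun setT w ->
    (forall t, 0 <= w t <= M%:E)%E -> E w x \is a fin_num.
  move=> mw wM; have /andP[e0 eM] := bound w x mw wM.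
  by rewrite ge0_fin_numE//; apply: le_lt_trans eM _; rewrite ltry.
have fineM w x : measurable_fun setT w ->
    (forall t, 0 <= w t <= M%:E)%E -> 0 <= fine (E w x) <= M.
  by move=> mw wM; rewrite -!lee_fin fineK ?fin//; exact: bound.
have mE w : measurable_fun setT w -> (forall t, 0 <= w t)%E ->
    measurable_fun setT (fun x => fine (E w x)).
  move=> mw w0; apply: measurableT_comp => //; exact: measurable_expectT_cons.
have intE w : measurable_fun setT w -> (forall t, 0 <= w t <= M%:E)%E ->
    expectT w = (\int[leb]_x (exp_weight x * fine (E w x))%:E)%E.
  move=> mw wM; rewrite expectT_cons//; last by move=> t; have /andP[] := wM t.
  by apply: eq_integral => x _; rewrite EFinM fineK// fin.
rewrite (intE u)// (intE v)//; apply: (@exp_two_function_real _ _ _ M).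
- exact: mE.
- exact: mE.
- by move=> x; exact: fineM.
- by move=> x; exact: fineM.
move=> x y x0 y0; set k := kappa x y; have k0 : 0 < k by exact: kappa_gt0.
have kV0 : 0 <= k^-1 by rewrite invr_ge0 ltW.
suff : k^-1 * fine (E u x) * fine (E v y) <= 1.
  by rewrite -mulrA => h; rewrite -[leRHS]mulr1 -ler_pdivrMl.
rewrite -lee_fin !EFinM !fineK ?fin// -expectTZ//; last exact: measurable_fun_cons.
apply: (ih _ _ (Num.max M (k^-1 * M))).
- by apply: emeasurable_funM => //; exact: measurable_fun_cons.
- exact: measurable_fun_cons.
- move=> t; have /andP[h0 h1] := uM (cons_tuple x t).
  rewrite mule_ge0//=; apply: (@le_trans _ _ (k^-1%:E * M%:E)%E).
    by rewrite lee_wpmul2l.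
  by rewrite -EFinM lee_fin le_max lexx orbT.
- move=> t; have /andP[-> h1] /= := vM (cons_tuple y t).
  by apply: le_trans h1 _; rewrite lee_fin le_max lexx.
move=> s t sp tp; rewrite -muleA.
have := uv (cons_tuple x s) (cons_tuple y t).
rewrite kappaT_cons => /(_ _ _)/= h.
rewrite -[kappaT s t](@mulKf _ k) ?lt0r_neq0// EFinM lee_wpmul2l//.
by apply: h => i; case: (unliftP ord0 i) => [j|] ->; rewrite ?tnthS ?tnth0.
Qed.

End tensor.

(** * Two sets at a Euclidean distance *)

Section l2.
Context {R : realType}.

Definition l2 m (z : 'I_m -> R) : R := Num.sqrt (\sum_(i < m) z i ^+ 2).

Lemma l2_ge0 m (z : 'I_m -> R) : 0 <= l2 z. Proof. exact: sqrtr_ge0. Qed.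

Lemma sumsq_ge0 m (z : 'I_m -> R) : 0 <= \sum_(i < m) z i ^+ 2.
Proof. by apply: sumr_ge0 => i _; exact: sqr_ge0. Qed.

Lemma l2_sqr m (z : 'I_m -> R) : l2 z ^+ 2 = \sum_(i < m) z i ^+ 2.
Proof. by rewrite sqr_sqrtr// sumsq_ge0. Qed.

Lemma minkowski2 (a b c d : R) : 0 <= a -> 0 <= b ->
  Num.sqrt ((a + b) ^+ 2 + (c + d) ^+ 2) <=
  Num.sqrt (a ^+ 2 + c ^+ 2) + Num.sqrt (b ^+ 2 + d ^+ 2).
Proof.
move=> a0 b0; set p := a ^+ 2 + c ^+ 2; set r := b ^+ 2 + d ^+ 2.
have p0 : 0 <= p by rewrite addr_ge0// sqr_ge0.
have r0 : 0 <= r by rewrite addr_ge0// sqr_ge0.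
rewrite -[leRHS]ger0_norm ?addr_ge0 ?sqrtr_ge0// -sqrtr_sqr ler_wsqrtr//.
rewrite [leRHS]sqrrD !sqr_sqrtr// -sqrtrM//.
have : a * b + c * d <= Num.sqrt (p * r).
  apply: le_trans (ler_norm _) _; rewrite -sqrtr_sqr ler_wsqrtr// /p /r.
  by have := sqr_ge0 (a * d - b * c); nra.
by rewrite /p /r mulr2n; nra.
Qed.

Lemma l2D m (y z : 'I_m -> R) : l2 (fun i => y i + z i) <= l2 y + l2 z.
Proof.
elim: m y z => [|m ih] y z; first by rewrite /l2 !big_ord0 sqrtr0 addr0.
rewrite /l2 !big_ord_recr /=.
have := ih (fun i => y (widen_ord (leqnSn m) i)) (fun i => z (widen_ord (leqnSn m) i)).
rewrite -!l2_sqr; move: (l2_ge0 (fun i => y (widen_ord (leqnSn m) i)))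
  (l2_ge0 (fun i => z (widen_ord (leqnSn m) i)))
  (l2_ge0 (fun i => y (widen_ord (leqnSn m) i) + z (widen_ord (leqnSn m) i))).
move: (l2 _) (l2 _) (l2 _) => a b c a0 b0 c0 cab.
apply: le_trans (minkowski2 _ _ a0 b0).
by rewrite ler_wsqrtr// lerD2r ler_pXn2r ?nnegrE// addr_ge0.
Qed.

Lemma l2Z m (k : R) (z : 'I_m -> R) : l2 (fun i => k * z i) = `|k| * l2 z.
Proof.
rewrite /l2 -sqrtr_sqr -sqrtrM ?sqr_ge0// mulr_sumr.
by congr Num.sqrt; apply: eq_bigr => i _; rewrite exprMn.
Qed.

(** The sum of the squares of z_i minus their mean is nonnegative. *)
Lemma sum_le_l2 m (z : 'I_m -> R) : `|\sum_(i < m) z i| <= Num.sqrt m%:R * l2 z.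
Proof.
case: m z => [|m] z; first by rewrite big_ord0 normr0 mulr_ge0// ?sqrtr_ge0// l2_ge0.
set D := \sum_(i < _) z i; set M : R := m.+1%:R.
have M0 : 0 < M by rewrite ltr0n.
rewrite /l2 -sqrtrM ?ler0n// -sqrtr_sqr ler_wsqrtr// mulrC -ler_pdivrMr//.
have : 0 <= \sum_(i < m.+1) (z i - D / M) ^+ 2 by apply: sumr_ge0 => i _; exact: sqr_ge0.
have -> : \sum_(i < m.+1) (z i - D / M) ^+ 2 =
    \sum_(i < m.+1) z i ^+ 2 - (2 * (D / M)) * D + M * (D / M) ^+ 2.
  have -> : M * (D / M) ^+ 2 = \sum_(i < m.+1) (D / M) ^+ 2.
    by rewrite sumr_const card_ord mulr_natl.
  rewrite mulr_sumr -sumrB -big_split/=.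
  by apply: eq_bigr => i _; ring.
move=> h; rewrite -subr_ge0; apply: le_trans h _; rewrite le_eqVlt; apply/orP; left.
apply/eqP; field.
by rewrite lt0r_neq0.
Qed.

End l2.

Section two_sets.
Context {R : realType}.
Local Notation RR := (measurableTypeR R).

(** sqrt (1 + a) - 1 is concave in a and vanishes at 0, so it is subadditive. *)
Lemma sqrt1D_sub (a b : R) : 0 <= a -> 0 <= b ->
  Num.sqrt (1 + (a + b)) - 1 <= (Num.sqrt (1 + a) - 1) + (Num.sqrt (1 + b) - 1).
Proof.
move=> a0 b0; suff : 1 + Num.sqrt (1 + (a + b)) <= Num.sqrt (1 + a) + Num.sqrt (1 + b) by lra.
have h : Num.sqrt (1 + (a + b)) <= Num.sqrt ((1 + a) * (1 + b)).
  by rewrite ler_wsqrtr//; nra.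
rewrite sqrtrM in h; last by lra.
rewrite -(@ler_pXn2r _ 2) ?nnegrE ?addr_ge0 ?sqrtr_ge0// !sqrrD !sqr_sqrtr; lra.
Qed.

Lemma sum_sqrt1D m (z : 'I_m -> R) :
  Num.sqrt (1 + \sum_(i < m) z i ^+ 2) - 1 <= \sum_(i < m) (Num.sqrt (1 + z i ^+ 2) - 1).
Proof.
elim: m z => [|m ih] z; first by rewrite !big_ord0 addr0 sqrtr1 subrr.
rewrite !big_ord_recr/=; apply: le_trans (sqrt1D_sub _ _) _.
- exact: sumsq_ge0.
- exact: sqr_ge0.
by rewrite lerD2r; exact: ih.
Qed.

Lemma kappaE (x y : R) (z := (x - y) / 4) :
  kappa x y = ((expR z + expR (- z)) / 2) ^+ 2.
Proof.
rewrite /kappa; set a := expR (- (x + y) / 4).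
have a0 : a != 0 by rewrite lt0r_neq0// expR_gt0.
have -> : half_exp x = a * expR (- z) by rewrite /half_exp -expRD; congr (expR _); rewrite /z; field.
have -> : half_exp y = a * expR z by rewrite /half_exp -expRD; congr (expR _); rewrite /z; field.
have h : expR z * expR (- z) = 1 by exact: expRxMexpNx_1.
rewrite expRN; field.
by rewrite a0 lt0r_neq0// expR_gt0.
Qed.

(** The exponent is at most z^2 / 8 and at most z / 4. The first bound is used
for z <= 2, with cosh z >= 1 + z^2 / 8, and the second for z > 2, with
cosh z >= e^z / 2. *)
Lemma cosh_sqr_ge (z : R) :
  expR (4^-1 * (Num.sqrt (1 + z ^+ 2) - 1)) <= ((expR z + expR (- z)) / 2) ^+ 2.
Proof.
wlog z0 : z / 0 <= z.
  move=> h; have [|/ltW z0] := leP 0 z; first exact: h.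
  by have := h (- z); rewrite oppr_ge0 sqrrN opprK [expR (- z) + _]addrC; apply.
have e0 : 0 < expR z := expR_gt0 z.
have [z2|z2] := leP z 2.
  have phi : Num.sqrt (1 + z ^+ 2) - 1 <= z ^+ 2 / 2.
    suff : Num.sqrt (1 + z ^+ 2) <= 1 + z ^+ 2 / 2 by lra.
    have p0 : 0 <= 1 + z ^+ 2 / 2 by have := sqr_ge0 z; lra.
    rewrite -[leRHS]ger0_norm// -sqrtr_sqr ler_wsqrtr//.
    by have := sqr_ge0 (z ^+ 2); nra.
  have c1 : 1 + z ^+ 2 / 8 <= (expR z + expR (- z)) / 2.
    have h1 : (1 + z / 2) ^+ 2 <= expR z.
      have -> : expR z = expR (z / 2) ^+ 2 by rewrite expr2 -expRD; congr (expR _); field.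
      rewrite ler_pXn2r ?nnegrE ?expR_ge0//; first exact: expR_ge1Dx.
      by rewrite addr_ge0// divr_ge0.
    by have := expR_ge1Dx (- z); nra.
  have c2 : 1 + z ^+ 2 / 4 <= ((expR z + expR (- z)) / 2) ^+ 2.
    have p0 : 0 <= 1 + z ^+ 2 / 8 by have := sqr_ge0 z; lra.
    apply: (@le_trans _ _ ((1 + z ^+ 2 / 8) ^+ 2)).
      by have := sqr_ge0 (z ^+ 2); nra.
    by rewrite ler_pXn2r// nnegrE// (le_trans p0).
  apply: le_trans c2; set a := z ^+ 2 / 8.
  have a0 : 0 <= a by rewrite divr_ge0// sqr_ge0.
  have a1 : a <= 2^-1 by rewrite /a; nra.
  apply: (@le_trans _ _ (expR a)); first by rewrite ler_expR /a; lra.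
  have -> : 1 + z ^+ 2 / 4 = 1 + 2 * a by rewrite /a; field.
  have := expR_ge1Dx (- a); rewrite expRN -(ler_pM2r (expR_gt0 a)) mulVf ?lt0r_neq0 ?expR_gt0//.
  by have := expR_gt0 a; nra.
have phi : Num.sqrt (1 + z ^+ 2) - 1 <= z.
  suff : Num.sqrt (1 + z ^+ 2) <= 1 + z by lra.
  have p0 : 0 <= 1 + z by lra.
  by rewrite -[leRHS]ger0_norm// -sqrtr_sqr ler_wsqrtr//; nra.
apply: (@le_trans _ _ ((expR z / 2) ^+ 2)); last first.
  rewrite ler_pXn2r ?nnegrE ?divr_ge0 ?addr_ge0 ?expR_ge0//.
  by rewrite ler_pM2r// lerDl expR_ge0.
apply: (@le_trans _ _ (expR (4^-1 * z))); first by rewrite ler_expR; lra.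
have -> : (expR z / 2) ^+ 2 = expR (4^-1 * z) * (expR (7 / 4 * z) / 4).
  have -> : expR (7 / 4 * z) = expR z ^+ 2 / expR (4^-1 * z).
    by rewrite expr2 -expRD -expRB; congr (expR _); field.
  by field; rewrite lt0r_neq0// expR_gt0.
rewrite ler_peMr ?expR_ge0// ler_pdivlMr// mul1r.
by apply: le_trans (expR_ge1Dx _); lra.
Qed.

Definition tdist m (s t : m.-tuple RR) : R :=
  l2 (fun i : 'I_m => (tnth s i : R) - (tnth t i : R)).

(** The function sqrt (1 + z^2) - 1 is quadratic near 0 and linear at infinity.
By subadditivity, its sum over the coordinates is at least its value at the
Euclidean norm. *)
Lemma kappaT_ge m (s t : m.-tuple RR) :
  expR (tdist s t / 16 - 4^-1) <= kappaT s t.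
Proof.
pose z (i : 'I_m) : R := ((tnth s i : R) - (tnth t i : R)) / 4.
apply: (@le_trans _ _ (expR (4^-1 * \sum_(i < m) (Num.sqrt (1 + z i ^+ 2) - 1)))).
  rewrite ler_expR; apply: (@le_trans _ _ (4^-1 * (l2 z - 1))).
    rewrite /tdist (_ : l2 z = l2 (fun i : 'I_m => (tnth s i : R) - (tnth t i : R)) / 4).
      by rewrite le_eqVlt; apply/orP; left; apply/eqP; field.
    rewrite mulrC -[X in X * _]ger0_norm ?invr_ge0// -l2Z.
    by congr l2; apply/funext => i; rewrite /z mulrC.
  rewrite ler_wpM2l// ?invr_ge0//; apply: le_trans (sum_sqrt1D z).
  by rewrite lerD2r ler_wsqrtr// lerDr.
rewrite mulr_sumr expR_sum; apply: ler_prod => i _; rewrite expR_ge0/=.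
by rewrite kappaE; exact: cosh_sqr_ge.
Qed.

(** The probability of A under the product of standard exponential laws. *)
Definition expP m (A : set (m.-tuple RR)) : \bar R := expectT (fun t => (\1_A t)%:E).

(** The two-function inequality for the indicators of A and B, one of them
multiplied by exp (eta / 16 - 1/4). *)
Lemma two_sets m (A B : set (m.-tuple RR)) (eta : R) :
  measurable A -> measurable B ->
  (forall s t, A s -> B t -> eta <= tdist s t) ->
  (expP A * expP B <= (expR (4^-1 - eta / 16))%:E)%E.
Proof.
move=> mA mB AB; set c := expR (eta / 16 - 4^-1).
have c0 : 0 < c := expR_gt0 _.
have mI C : measurable C -> measurable_fun setT (fun t : m.-tuple RR => (\1_C t)%:E : \bar R).
  by move=> mC; exact/measurable_EFinP/measurable_indic.
have I0 C (t : m.-tuple RR) : (0 <= (\1_C t : R)%:E)%E by rewrite lee_fin.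
have I1 C (t : m.-tuple RR) : (\1_C t : R) <= 1 by rewrite indicE lern1 leq_b1.
have : (expectT (fun t => c%:E * (\1_A t)%:E) * expP B <= 1)%E.
  apply: (@two_function _ _ _ _ (Num.max c 1)).
  - by apply: emeasurable_funM => //; exact: mI.
  - exact: mI.
  - move=> t; rewrite -EFinM !lee_fin mulr_ge0 ?(ltW c0)//=.
    by rewrite le_max -[X in _ <= X]mulr1 ler_wpM2l// ltW.
  - by move=> t; rewrite I0/= lee_fin le_max I1 orbT.
  move=> s t _ _; rewrite -!EFinM lee_fin !indicE.
  have k0 : 0 <= kappaT s t by apply: prodr_ge0 => i _; exact/ltW/kappa_gt0.
  case: (boolP (s \in A)) => [/set_mem sA|_]; last by rewrite mulr0 mul0r.
  case: (boolP (t \in B)) => [/set_mem tB|_]; last by rewrite mulr0.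
  rewrite !mulr1; apply: le_trans (kappaT_ge s t).
  by rewrite ler_expR lerD2r ler_pM2r// AB.
rewrite expectTZ//; [|exact: mI|exact: ltW].
rewrite -/(expP A) -muleA -lee_pdivlMl// mule1; congr (_ <= _%:E)%E.
by rewrite /c -expRN opprB.
Qed.

End two_sets.

(** * The exponential law on rays is uniform on the corner *)

Section cone.
Context {R : realType}.
Local Notation RR := (measurableTypeR R).
Local Notation leb := (@lebesgue_measure R).

Lemma scales_integral m (c : R) (T : m.-tuple RR -> m.-tuple RR)
    (f : m.-tuple RR -> \bar R) : 0 <= c -> scales c T ->
  measurable_fun setT f -> (forall t, 0 <= f t)%E ->
  (\int[lebT m]_t f (T t) = c%:E * \int[lebT m]_t f t)%E.
Proof.
move=> c0 [mT cT] mf f0.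
rewrite -(@ge0_integral_mscale _ _ _ (lebT m) setT measurableT (NngNum c0) f)//.
pose nu : {measure set (m.-tuple RR) -> \bar R} :=
  image_measure (lebT m) mT.
transitivity (\int[nu]_t f t)%E.
  by rewrite (@ge0_integral_pushforward _ _ _ _ _ _ mT).
by apply: eq_measure_integral => A mA _; rewrite /= /mscale/= -cT.
Qed.

Lemma measurable_scale_by m (d : measure_display) (T : measurableType d)
    (k : T -> R) (g : T -> m.-tuple RR) :
  measurable_fun setT k -> measurable_fun setT g ->
  measurable_fun setT (fun p => affine (k p) 0 (g p)).
Proof.
move=> mk mg; apply/measurable_fun_tnthP => i.
rewrite (_ : _ \o _ = (fun p => k p * (tnth (g p) i : R) + 0)).
  apply: measurable_funD => //; apply: measurable_funM => //.
  exact: ((measurable_fun_tnthP _).1 mg i).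
by apply/funext => p /=; rewrite tnth_map.
Qed.

(** The free coordinates of the point of the simplex on the ray through p; the
first coordinate of p becomes the dependent one. The inverse is written as a power
with exponent -1, so that its measurability is that of powers. *)
Definition ray m (p : m.+1.-tuple RR) : m.-tuple RR :=
  affine (tsum p `^ (-1)) 0 (behead_tuple p).

Lemma measurable_ray m : measurable_fun setT (@ray m).
Proof.
apply: measurable_scale_by; last exact: measurable_behead.
by apply: (measurableT_comp (@measurable_powR R (-1))); exact: measurable_tsum.
Qed.

Definition cone m (B : set (m.-tuple RR)) : set (m.+1.-tuple RR) := @ray m @^-1` B.

Lemma measurable_cone m (B : set (m.-tuple RR)) : measurable B -> measurable (cone B).
Proof. by move=> mB; rewrite -[X in measurable X]setTI; exact: measurable_ray. Qed.

Lemma corner_scale m (s rho : R) (t : m.-tuple RR) : 0 < s ->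
  corner m rho (affine s^-1 0 t) <-> corner m (s * rho) t.
Proof.
move=> s0; rewrite /corner /= tsum_affine mulr0 addr0 ltr_pdivrMl//.
split => -[h hs]; split => // i; have := h i;
  by rewrite tnth_map addr0 pmulr_rgt0 ?invr_gt0.
Qed.

Lemma tsum_gt0 m (t : m.+1.-tuple RR) : (forall i, 0 < (tnth t i : R)) -> 0 < tsum t.
Proof.
move=> tp; rewrite /tsum big_ord_recl ltr_pwDl ?tp//.
by apply: sumr_ge0 => i _; exact/ltW/tp.
Qed.

Lemma exp_weightTE m (t : m.-tuple RR) : (forall i, 0 < (tnth t i : R)) ->
  exp_weightT t = expR (- tsum t).
Proof.
move=> tp; rewrite /exp_weightT /tsum -sumrN expR_sum.
by apply: eq_bigr => i _; rewrite /exp_weight tp.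
Qed.

(** The Gamma integral of s^m e^-s over s > 0. *)
Definition gamma_int m : \bar R := (\int[leb]_s (exp_weight s * s ^+ m)%:E)%E.

(** In the coordinates s = sum p and t = the tail of p, the density is e^-s, and
for fixed s the condition is that t lies in s B, a set of measure s^m |B|. *)
Lemma expP_cone_gamma m (B : set (m.-tuple RR)) :
  measurable B -> B `<=` corner m 1 ->
  expP (cone B) = (gamma_int m * lebT m B)%E.
Proof.
move=> mB B1.
pose f (p : m.+1.-tuple RR) : \bar R :=
  (exp_weight (thead p) * \1_B (affine ((thead p : R) `^ (-1)) 0 (behead_tuple p)))%:E.
have mdir : measurable_fun setT (fun p : m.+1.-tuple RR =>
    affine ((thead p : R) `^ (-1)) 0 (behead_tuple p)).
  apply: measurable_scale_by; last exact: measurable_behead.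
  by apply: (measurableT_comp (@measurable_powR R (-1))); exact: measurable_thead.
have mf : measurable_fun setT f.
  apply/measurable_EFinP; apply: measurable_funM.
    by apply: measurableT_comp; [exact: measurable_exp_weight|exact: measurable_thead].
  by apply: measurableT_comp => //; exact: measurable_indic.
have f0 p : (0 <= f p)%E by rewrite lee_fin mulr_ge0 ?exp_weight_ge0.
pose T := head_affine 1 (@tsum R m).
have sT : scales 1 T.
  by rewrite -[X in scales X]invr1; apply: scales_head_affine => //; exact: measurable_tsum.
rewrite /expP /expectT.
transitivity (\int[lebT m.+1]_p f (T p))%E.
  apply: eq_integral => p _; rewrite -EFinM /f /T /head_affine theadE behead_cons.
  congr EFin.
  have [x [t pE]] := tuple_cons_ex p.
  have hS : 1 * (thead p : R) + tsum (behead_tuple p) = tsum p.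
    by rewrite pE theadE behead_cons tsum_cons mul1r.
  rewrite hS.
  have -> : \1_(cone B) p = \1_B (ray p) :> R.
    by rewrite !indicE; congr (nat_of_bool _)%:R; apply/idP/idP; rewrite !inE.
  have [S0|S0] := leP (tsum p) 0.
    have -> : exp_weight (tsum p) = 0 by rewrite /exp_weight ltNge S0.
    have [/tsum_gt0|->] := exp_weightT_pos p; last by rewrite !mul0r.
    by rewrite ltNge S0.
  rewrite indicE; case: (boolP (ray p \in B)) => [/set_mem rB|rB]; last first.
    by rewrite !mulr0.
  rewrite !mulr1.
  move: (B1 _ rB); rewrite /ray powR_inv1 ?ltW// corner_scale// mulr1 => -[tp ts].
  rewrite exp_weightTE ?/exp_weight ?S0// => i.
  rewrite pE; case: (unliftP ord0 i) => [j|] ->; rewrite ?tnthS ?tnth0.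
    by have := tp j; rewrite pE behead_cons.
  by move: ts; rewrite pE behead_cons tsum_cons ltrDr.
rewrite (scales_integral ler01 sT mf f0) mul1e integral_cons_measure//.
rewrite /gamma_int -ge0_integralZr//; last 2 first.
- apply/measurable_EFinP; apply: measurable_funM; first exact: measurable_exp_weight.
  exact: measurable_funX.
- move=> s _; rewrite lee_fin /exp_weight; case: ifPn => [s0|_]; last by rewrite mul0r.
  by rewrite mulr_ge0 ?expR_ge0// exprn_ge0// ltW.
apply: eq_integral => s _.
transitivity (\int[lebT m]_t ((exp_weight s)%:E * (\1_B (affine ((s : R) `^ (-1)) 0 t))%:E))%E.
  by apply: eq_integral => t _; rewrite /f theadE behead_cons EFinM.
have [s0|s0] := leP (s : R) 0.
  have -> : exp_weight s = 0 by rewrite /exp_weight ltNge s0.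
  by rewrite mul0r mul0e; apply: integral0_eq => t _; rewrite mul0e.
rewrite powR_inv1 ?(ltW s0)//.
have sV0 : 0 < (s : R)^-1 by rewrite invr_gt0.
have [ma sa] := @scales_affine R m (s : R)^-1 0 sV0.
have mBs : measurable (affine (s : R)^-1 0 @^-1` B : set (m.-tuple RR)).
  by rewrite -[X in measurable X]setTI; exact: ma.
rewrite ge0_integralZl//; last 2 first.
- apply/measurable_EFinP; apply: measurableT_comp => //; exact: measurable_indic.
- by rewrite lee_fin exp_weight_ge0.
rewrite EFinM -muleA; congr (_ * _)%E.
rewrite -exprVn invrK in sa; rewrite -sa// -[RHS](congr1 (lebT m) (setIT _)).
by rewrite -integral_indic.
Qed.

(** The cone over the whole corner has probability 1, and the corner has volume
1 / m!. *)
Lemma gamma_int_fact m : gamma_int m = (m`!%:R)%:E.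
Proof.
have f0 : 0 < (m`!%:R : R) by rewrite ltr0n fact_gt0.
have := expP_cone_gamma (@measurable_corner R m 1) (@subset_refl _ _).
rewrite lebT_corner// expr1n div1r.
have -> : expP (cone (corner m 1)) = 1%E.
  rewrite -[RHS](@expectT1 R m.+1); apply: eq_integral => p _.
  have [pp|->] := exp_weightT_pos p; last by rewrite !mul0e.
  congr (_ * _)%E; rewrite indicE mem_set//.
  have S0 := tsum_gt0 pp; rewrite /cone/= /ray powR_inv1 ?(ltW S0)//.
  rewrite corner_scale// mulr1; have [x [t pE]] := tuple_cons_ex p.
  rewrite pE behead_cons; split.
    by move=> i; have := pp (lift ord0 i); rewrite pE tnthS.
  by rewrite tsum_cons ltrDr; have := pp ord0; rewrite pE tnth0.
move=> h; rewrite -[LHS]mule1.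
have -> : (1 = (m`!%:R^-1)%:E * (m`!%:R)%:E :> \bar R)%E.
  by rewrite -EFinM mulVf ?lt0r_neq0.
by rewrite muleA -h mul1e.
Qed.

Lemma expP_cone m (B : set (m.-tuple RR)) :
  measurable B -> B `<=` corner m 1 ->
  expP (cone B) = (m`!%:R%:E * lebT m B)%E.
Proof. by move=> mB B1; rewrite expP_cone_gamma// gamma_int_fact. Qed.

End cone.

(** * Large sums and norms *)

Section events.
Context {R : realType}.
Local Notation RR := (measurableTypeR R).
Local Notation leb := (@lebesgue_measure R).

Lemma measurable_indicE m (A : set (m.-tuple RR)) : measurable A ->
  measurable_fun setT (fun t : m.-tuple RR => (\1_A t)%:E : \bar R).
Proof. by move=> mA; exact/measurable_EFinP/measurable_indic. Qed.

Lemma expP_split m (A B : set (m.-tuple RR)) : measurable A -> measurable B ->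
  (expP A <= expP (A `&` B) + expP (~` B))%E.
Proof.
move=> mA mB; have mAB := measurableI _ _ mA mB; have mC := measurableC mB.
rewrite /expP -expectTD//; try exact: measurable_indicE; try by move=> t; rewrite lee_fin.
apply: le_expectT; try exact: measurable_indicE; try by move=> t; rewrite lee_fin.
  by apply: emeasurable_funD; exact: measurable_indicE.
move=> t _; rewrite -EFinD lee_fin !indicE in_setI in_setC.
by case: (t \in A); case: (t \in B); rewrite /= ?(addr0, add0r)// ?ler01 ?lexx.
Qed.

Lemma expPC m (A : set (m.-tuple RR)) : measurable A -> (expP A + expP (~` A) = 1)%E.
Proof.
move=> mA; have mC := measurableC mA.
rewrite /expP -expectTD//; try exact: measurable_indicE; try by move=> t; rewrite lee_fin.
rewrite -[RHS](@expectT1 R m); congr expectT; apply/funext => t.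
by rewrite -EFinD !indicE in_setC; case: (t \in A); rewrite /= ?addr0 ?add0r.
Qed.

(** Markov's inequality for exp (- sum p): the expectation of exp (1/2 - x) is
sqrt e / 2 < 1. *)
Lemma expP_sum_small n :
  (expP [set p : n.-tuple RR | (tsum p < n%:R / 2)%R] <= ((expR (2^-1) / 2) ^+ n)%:E)%E.
Proof.
pose phi (x : R) : R := expR 2^-1 * expR ((1 - 2) * x).
have mphi : measurable_fun setT phi.
  apply: measurable_funM => //; apply: measurableT_comp => //; exact: measurable_funM.
have phi0 x : 0 <= phi x by rewrite mulr_ge0 ?expR_ge0.
have hphi : (\int[leb]_x (exp_weight x * phi x)%:E = (expR 2^-1 / 2)%:E)%E.
  rewrite EFinM -(integral_exp_weight (@ltr0n R 2)) -ge0_integralZl//.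
  - by apply: eq_integral => x _; rewrite -EFinM mulrCA.
  - apply/measurable_EFinP; apply: measurable_funM; first exact: measurable_exp_weight.
    by apply: measurableT_comp => //; exact: measurable_funM.
  - by move=> x _; rewrite lee_fin mulr_ge0 ?exp_weight_ge0 ?expR_ge0.
have mS : measurable [set p : n.-tuple RR | tsum p < n%:R / 2].
  rewrite (_ : mkset _ = @tsum _ n @^-1` `]-oo, n%:R / 2[).
    by rewrite -[X in measurable X]setTI; exact: measurable_tsum.
  by apply/seteqP; split => t /=; rewrite in_itv.
rewrite -(expectT_prod n mphi phi0 hphi); apply: le_expectT.
- exact: measurable_indicE.
- apply/measurable_EFinP; apply: measurable_prod => i _.
  by apply: measurableT_comp => //; exact: measurable_tnth.
- by move=> t; rewrite lee_fin.
move=> t _; rewrite lee_fin indicE.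
have -> : \prod_(i < n) phi (tnth t i) = expR (n%:R / 2 - tsum t).
  rewrite /phi big_split/= prodr_const card_ord -expRM_natl -expR_sum -expRD.
  congr expR; congr (_ + _); rewrite -mulr_sumr -/(tsum t); ring.
case: (boolP (_ \in _)) => [|_]; last exact: expR_ge0.
by rewrite inE/= => h; apply: le_trans (expR_ge1Dx _); lra.
Qed.

Lemma expectT_sum m (phi : R -> R) (c : R) : measurable_fun setT phi ->
  (forall x, 0 <= phi x) ->
  (\int[leb]_x (exp_weight x * phi x)%:E = c%:E)%E ->
  expectT (fun t : m.-tuple RR => (\sum_(i < m) phi (tnth t i))%:E) = (m%:R * c)%:E.
Proof.
move=> mphi phi0 hc.
have c0 : 0 <= c.
  rewrite -lee_fin -hc; apply: integral_ge0 => x _.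
  by rewrite lee_fin mulr_ge0 ?exp_weight_ge0.
have mp k : measurable_fun setT (fun t : k.-tuple RR => (\sum_(i < k) phi (tnth t i))%:E).
  apply/measurable_EFinP; apply: measurable_sum => i.
  by apply: measurableT_comp => //; exact: measurable_tnth.
have p0 k (t : k.-tuple RR) : (0 <= (\sum_(i < k) phi (tnth t i))%:E)%E.
  by rewrite lee_fin; apply: sumr_ge0.
have w1 : (\int[leb]_x (exp_weight x)%:E = 1)%E.
  have := integral_exp_weight (@ltr01 R); rewrite invr1 => <-.
  by apply: eq_integral => x _; rewrite subrr mul0r expR0 mulr1.
elim: m => [|m ih]; first by rewrite expectT0// big_ord0 mul0r.
rewrite expectT_cons//.
transitivity (\int[leb]_x ((exp_weight x * phi x)%:E + (m%:R * c)%:E * (exp_weight x)%:E))%E.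
  apply: eq_integral => x _; rewrite EFinM [((m%:R * c)%:E * _)%E]muleC -ge0_muleDr; last 2 first.
  - by rewrite lee_fin.
  - by rewrite lee_fin mulr_ge0.
  congr (_ * _)%E.
  transitivity (expectT (fun t : m.-tuple RR => (phi x)%:E * (fun _ => 1) t + (\sum_(i < m) phi (tnth t i))%:E))%E.
    congr expectT; apply/funext => t.
    rewrite big_ord_recl tnth0 mule1 EFinD; congr (_ + (_)%:E)%E.
    by apply: eq_bigr => i _; rewrite tnthS.
  rewrite expectTD//; [|by move=> t; rewrite mule1 lee_fin].
  by rewrite expectTZ// expectT1 mule1 ih.
rewrite ge0_integralD//; last 4 first.
- by move=> x _; rewrite lee_fin mulr_ge0 ?exp_weight_ge0.
- apply/measurable_EFinP; apply: measurable_funM => //; exact: measurable_exp_weight.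
- by move=> x _; rewrite -EFinM lee_fin !mulr_ge0 ?exp_weight_ge0.
- by apply/measurable_EFinP; apply: measurable_funM => //; exact: measurable_exp_weight.
rewrite hc ge0_integralZl//; last 3 first.
- by apply/measurable_EFinP; exact: measurable_exp_weight.
- by move=> x _; rewrite lee_fin exp_weight_ge0.
- by rewrite lee_fin mulr_ge0.
by rewrite w1 mule1 -EFinD; congr EFin; rewrite -natr1; ring.
Qed.

Definition tnorm m (t : m.-tuple RR) : R := l2 (fun i : 'I_m => tnth t i : R).

Lemma measurable_tnorm m : measurable_fun setT (@tnorm m).
Proof.
apply: measurableT_comp; first exact: (continuous_measurable_fun (@sqrt_continuous R)).
by apply: measurable_sum => i; apply: measurable_funX; exact: measurable_tnth.
Qed.

Lemma measurable_tnorm_gt m (r : R) : measurable [set t : m.-tuple RR | r < tnorm t].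
Proof.
rewrite (_ : mkset _ = @tnorm m @^-1` `]r, +oo[).
  by rewrite -[X in measurable X]setTI; exact: measurable_tnorm.
by apply/seteqP; split => t /=; rewrite in_itv/= andbT.
Qed.

(** Markov's inequality for the squared norm, with x^2 <= 16 exp (x / 2), whose
expectation is 32. *)
Lemma expP_tnorm_gt8 n : (0 < n)%N ->
  (expP [set p : n.-tuple RR | (8 * Num.sqrt n%:R < tnorm p)%R] <= (2^-1)%:E)%E.
Proof.
move=> n0; pose phi (x : R) : R := 16 * expR ((1 - 2^-1) * x).
have mphi : measurable_fun setT phi.
  apply: measurable_funM => //; apply: measurableT_comp => //; exact: measurable_funM.
have phi0 x : 0 <= phi x by rewrite mulr_ge0 ?expR_ge0.
have hphi : (\int[leb]_x (exp_weight x * phi x)%:E = (32)%:E)%E.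
  transitivity (16%:E * (2^-1^-1)%:E : \bar R)%E; last by rewrite -EFinM; congr EFin; field.
  rewrite -(@integral_exp_weight R 2^-1)// -ge0_integralZl//.
  - by apply: eq_integral => x _; rewrite -EFinM mulrCA.
  - apply/measurable_EFinP; apply: measurable_funM; first exact: measurable_exp_weight.
    by apply: measurableT_comp => //; exact: measurable_funM.
  - by move=> x _; rewrite lee_fin mulr_ge0 ?exp_weight_ge0 ?expR_ge0.
have nR : 0 < (n%:R : R) by rewrite ltr0n.
set A := [set p | _]; have mA : measurable A by exact: measurable_tnorm_gt.
have : ((64 * n%:R)%:E * expP A <= (n%:R * 32)%:E)%E.
  rewrite -(expectT_sum n mphi phi0 hphi) -expectTZ//; last exact: measurable_indicE.
  apply: le_expectT.
  - by apply: emeasurable_funM => //; exact: measurable_indicE.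
  - apply/measurable_EFinP; apply: measurable_sum => i.
    by apply: measurableT_comp => //; exact: measurable_tnth.
  - by move=> t; rewrite -EFinM lee_fin !mulr_ge0// ltW.
  move=> t tp; rewrite -EFinM lee_fin indicE.
  case: (boolP (t \in A)) => [|_]; last by rewrite mulr0; exact: sumr_ge0.
  rewrite inE /A/= mulr1 => h.
  apply: (@le_trans _ _ (tnorm t ^+ 2)).
    have -> : 64 * n%:R = (8 * Num.sqrt n%:R) ^+ 2 :> R.
      by rewrite exprMn sqr_sqrtr ?ler0n//; ring.
    by rewrite ler_pXn2r ?nnegrE ?l2_ge0//; exact: ltW.
  rewrite /tnorm l2_sqr; apply: ler_sum => i _.
  have ti := tp i; set x : R := tnth t i in ti *.
  have h1 := expR_ge1Dx (x / 4).
  rewrite /phi; have -> : expR ((1 - 2^-1) * x) = expR (x / 4) ^+ 2.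
    by rewrite expr2 -expRD; congr (expR _); field.
  by nra.
rewrite -lee_pdivlMl; last by rewrite mulr_gt0.
by move/le_trans; apply; rewrite -EFinM lee_fin le_eqVlt; apply/orP; left; apply/eqP; field; rewrite lt0r_neq0.
Qed.

Lemma tnorm_tdist m (s t : m.-tuple RR) : tnorm t - tnorm s <= tdist s t.
Proof.
rewrite lerBlDr /tnorm.
have -> : (fun i : 'I_m => tnth t i : R) =
    (fun i => (-1) * ((tnth s i : R) - (tnth t i : R)) + (tnth s i : R)).
  by apply/funext => i; ring.
by apply: le_trans (l2D _ _) _; rewrite l2Z normrN1 mul1r.
Qed.

(** The points of norm at most 8 sqrt n have probability at least 1/2, and they are
at distance at least sqrt n from those of norm greater than 9 sqrt n. *)
Lemma expP_tnorm_gt9 n : (0 < n)%N ->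
  (expP [set p : n.-tuple RR | (9 * Num.sqrt n%:R < tnorm p)%R] <=
   (2 * expR (4^-1 - Num.sqrt n%:R / 16))%:E)%E.
Proof.
move=> n0; set A := [set p | _]; have mA : measurable A by exact: measurable_tnorm_gt.
pose G := [set p : n.-tuple RR | 8 * Num.sqrt n%:R < tnorm p].
have mG : measurable G by exact: measurable_tnorm_gt.
have mGC := measurableC mG.
have GA : (expP (~` G) * expP A <= (expR (4^-1 - Num.sqrt n%:R / 16))%:E)%E.
  apply: two_sets => // s t /negP; rewrite -leNgt /A/= => h1 h2.
  by apply: le_trans (tnorm_tdist s t); lra.
have hG : ((2^-1)%:E <= expP (~` G))%E.
  have := expPC mG; have := expP_tnorm_gt8 n0; rewrite -/G.
  have : (0 <= expP G)%E by apply: expectT_ge0 => t; rewrite lee_fin.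
  case: (expP G) => [a| |]//; case: (expP (~` G)) => [b| |]//.
  by rewrite !lee_fin -EFinD => _ h1 []; lra.
rewrite EFinM -lee_pdivrMl//; apply: le_trans GA.
by apply: lee_wpmul2r => //; apply: expectT_ge0 => t; rewrite lee_fin.
Qed.

End events.

(** * The upper bound *)

Section upper.
Context {R : realType}.
Local Notation RR := (measurableTypeR R).

Lemma enorm2E n (x : 'rV[R]_n) : enorm2 x = l2 (fun i => x ord0 i).
Proof. by []. Qed.

Lemma enorm2Z n (k : R) (x : 'rV[R]_n) : enorm2 (k *: x) = `|k| * enorm2 x.
Proof. by rewrite !enorm2E -l2Z; congr l2; apply/funext => i; rewrite mxE. Qed.

(** The coordinates are permuted: the first coordinate of p is the last one of the
point of the simplex. *)
Lemma enorm2_ray m (p q : m.+1.-tuple RR) : 0 < tsum p -> 0 < tsum q ->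
  enorm2 (simplex_point (ray p) - simplex_point (ray q)) =
  l2 (fun i => (tnth p i : R) / tsum p - (tnth q i : R) / tsum q).
Proof.
move=> p0 q0; rewrite enorm2E /l2 [in LHS]big_ord_recr [in RHS]big_ord_recl /=.
have lastE (w : m.+1.-tuple RR) : 0 < tsum w ->
    simplex_point (ray w) ord0 ord_max = (tnth w ord0 : R) / tsum w.
  move=> w0; rewrite simplex_point_last /ray tsum_affine mulr0 addr0 powR_inv1 ?(ltW w0)//.
  move: w0; have [x [t ->]] := tuple_cons_ex w; rewrite behead_cons tsum_cons tnth0 => w0.
  by field; rewrite lt0r_neq0.
have liftE (w : m.+1.-tuple RR) (i : 'I_m) : 0 < tsum w ->
    simplex_point (ray w) ord0 (widen_ord (leqnSn m) i) = (tnth w (lift ord0 i) : R) / tsum w.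
  move=> w0; rewrite simplex_point_lift /ray tnth_map addr0 powR_inv1 ?(ltW w0)// mulrC.
  by have [x [t ->]] := tuple_cons_ex w; rewrite behead_cons tnthS.
have subE (x y : 'rV[R]_m.+1) i : (x - y) ord0 i = x ord0 i - y ord0 i.
  by rewrite !mxE.
rewrite subE !lastE// addrC; congr (Num.sqrt (_ + _)); apply: eq_bigr => i _.
by rewrite subE !liftE.
Qed.

(** Write p / P - q / Q = (p - q) / P + (1/P - 1/Q) q, where P and Q are the sums
of the coordinates. Since |P - Q| <= sqrt n |p - q|, the factor is at most
2 / n + (4 / n^2) sqrt n * 9 sqrt n = 38 / n. *)
Lemma enorm2_ray_le m (p q : m.+1.-tuple RR) (n : R := m.+1%:R) :
  n / 2 <= tsum p -> n / 2 <= tsum q -> tnorm q <= 9 * Num.sqrt n ->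
  enorm2 (simplex_point (ray p) - simplex_point (ray q)) <= 38 / n * tdist p q.
Proof.
have n0 : 0 < n by rewrite ltr0n.
have n20 : 0 < n / 2 by rewrite divr_gt0.
move=> hp hq nq; have p0 := lt_le_trans n20 hp; have q0 := lt_le_trans n20 hq.
rewrite enorm2_ray//; set P := tsum p in hp p0 *; set Q := tsum q in hq q0 *.
set d := tdist p q; have d0 : 0 <= d := l2_ge0 _.
have -> : (fun i => (tnth p i : R) / P - (tnth q i : R) / Q) =
    (fun i => P^-1 * ((tnth p i : R) - (tnth q i : R)) + (P^-1 - Q^-1) * (tnth q i : R)).
  by apply/funext => i; ring.
apply: (le_trans (l2D _ _)); rewrite !l2Z -/(tdist p q) -/d -/(tnorm q).
have PV : P^-1 <= 2 / n by rewrite -invf_div lef_pV2.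
have QV : Q^-1 <= 2 / n by rewrite -invf_div lef_pV2.
have PV0 : 0 < P^-1 by rewrite invr_gt0.
have QV0 : 0 < Q^-1 by rewrite invr_gt0.
have s0 : 0 <= Num.sqrt n := sqrtr_ge0 _.
have sn : Num.sqrt n ^+ 2 = n by rewrite sqr_sqrtr// ltW.
have h1 : `|P^-1| * d <= 2 / n * d by rewrite gtr0_norm// ler_wpM2r.
have h2 : `|P^-1 - Q^-1| <= 4 / n ^+ 2 * (Num.sqrt n * d).
  have -> : P^-1 - Q^-1 = (P^-1 * Q^-1) * - (P - Q).
    by field; rewrite !lt0r_neq0.
  rewrite normrM normrN ger0_norm; last by rewrite mulr_ge0// ltW.
  apply: ler_pM => //; first by rewrite mulr_ge0// ltW.
    have -> : 4 / n ^+ 2 = 2 / n * (2 / n) by field; rewrite lt0r_neq0.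
    by apply: ler_pM => //; exact: ltW.
  by rewrite /P /Q /tsum -sumrB; exact: sum_le_l2.
have h3 : `|P^-1 - Q^-1| * tnorm q <= 4 / n ^+ 2 * (Num.sqrt n * d) * (9 * Num.sqrt n).
  by apply: ler_pM => //; exact: l2_ge0.
have h4 : 4 / n ^+ 2 * (Num.sqrt n * d) * (9 * Num.sqrt n) = 36 / n * d.
  transitivity (36 / n ^+ 2 * d * Num.sqrt n ^+ 2); first by ring.
  by rewrite sn; field; rewrite lt0r_neq0.
rewrite h4 in h3; apply: (le_trans (lerD h1 h3)).
by rewrite -mulrDl -mulrDl -natrD.
Qed.

Lemma omega_le m : (0 < m)%N -> omega R m.+1 <= m.+1%:R.
Proof.
move=> m0; have w0 : 0 < omega R m.+1 by exact: omega_gt0.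
rewrite -(@ler_pXn2r _ m) ?nnegrE ?(ltW w0)//.
apply: (@le_trans _ _ m`!%:R).
  rewrite -omega_pow// ler_peMr ?exprn_ge0 ?(ltW w0)//.
  by rewrite -[leLHS]sqrtr1 ler_wsqrtr// ler1n.
rewrite -natrX ler_nat; elim: {m0 w0} m => // m ih.
rewrite factS expnS leq_mul//; apply: leq_trans ih _.
by case: m => // m; rewrite leq_exp2r.
Qed.

Lemma expP_ge_sub (x w : R) (y z : \bar R) : (0 <= y)%E ->
  (x%:E <= y + z)%E -> (z <= w%:E)%E -> ((x - w)%:E <= y)%E.
Proof.
case: y => [y| |]; [|by move=> *; rewrite leey|by []].
case: z => [z| |] _; [|by rewrite leye_eq|by rewrite addeNy leeNy_eq].
by rewrite -EFinD !lee_fin => h1 h2; lra.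
Qed.

(** Lift the two sets to cones, and remove the points with a small sum or a large
norm: this costs eps / 2 in probability. The remaining points of the cones are at
distance at least D / 38, because omega_n <= n. *)
Lemma gap_bound m (B1 B2 : set (m.-tuple RR)) (eps D : R) : (0 < m)%N ->
  measurable B1 -> measurable B2 -> B1 `<=` corner m 1 -> B2 `<=` corner m 1 ->
  (eps%:E <= m`!%:R%:E * lebT m B1)%E -> (eps%:E <= m`!%:R%:E * lebT m B2)%E ->
  (forall s t, B1 s -> B2 t ->
     D <= enorm2 (omega R m.+1 *: simplex_point s - omega R m.+1 *: simplex_point t)) ->
  0 < eps ->
  (expR 2^-1 / 2) ^+ m.+1 <= eps / 4 ->
  2 * expR (4^-1 - Num.sqrt m.+1%:R / 16) <= eps / 4 ->
  (eps / 2) ^+ 2 <= expR (4^-1 - D / 38 / 16).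
Proof.
move=> m0 mB1 mB2 B1c B2c v1 v2 hD e0 d1 d2.
set n : R := m.+1%:R in d2 *; have n0 : 0 < n by rewrite ltr0n.
have w0 : 0 < omega R m.+1 by exact: omega_gt0.
pose S := [set p : m.+1.-tuple RR | tsum p < n / 2].
pose N := [set p : m.+1.-tuple RR | 9 * Num.sqrt n < tnorm p].
have mS : measurable S.
  rewrite (_ : S = @tsum _ m.+1 @^-1` `]-oo, n / 2[).
    by rewrite -[X in measurable X]setTI; exact: measurable_tsum.
  by apply/seteqP; split => t /=; rewrite in_itv.
have mN : measurable N by exact: measurable_tnorm_gt.
have mSC := measurableC mS; have mNC := measurableC mN.
have mC1 := measurable_cone mB1; have mC2 := measurable_cone mB2.
have P0 (A : set (m.+1.-tuple RR)) : (0 <= expP A)%E.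
  by apply: expectT_ge0 => t; rewrite lee_fin.
have c1 : ((eps - eps / 4)%:E <= expP (cone B1 `&` ~` S))%E.
  apply: (@expP_ge_sub _ _ _ (expP S)) => //.
    apply: le_trans v1 _; rewrite -expP_cone//.
    by have := expP_split mC1 mSC; rewrite setCK.
  by apply: le_trans (expP_sum_small _) _; rewrite lee_fin.
have c2 : ((eps - eps / 4)%:E <= expP (cone B2 `&` ~` S))%E.
  apply: (@expP_ge_sub _ _ _ (expP S)) => //.
    apply: le_trans v2 _; rewrite -expP_cone//.
    by have := expP_split mC2 mSC; rewrite setCK.
  by apply: le_trans (expP_sum_small _) _; rewrite lee_fin.
have mC2S := measurableI _ _ mC2 mSC.
have c3 : ((eps - eps / 4 - eps / 4)%:E <= expP ((cone B2 `&` ~` S) `&` ~` N))%E.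
  apply: (@expP_ge_sub _ _ _ (expP N)) => //.
    apply: le_trans c2 _.
    by have := expP_split mC2S mNC; rewrite setCK.
  by apply: le_trans (expP_tnorm_gt9 _) _; rewrite ?lee_fin.
have mC1S := measurableI _ _ mC1 mSC.
have mC3 := measurableI _ _ mC2S mNC.
have : (expP (cone B1 `&` ~` S) * expP ((cone B2 `&` ~` S) `&` ~` N) <=
    (expR (4^-1 - D / 38 / 16))%:E)%E.
  apply: two_sets => // p q [Bp /negP]; rewrite -leNgt => hp [[Bq /negP]].
  rewrite -leNgt => hq /negP; rewrite -leNgt => nq.
  rewrite ler_pdivrMr// mulrC.
  apply: (le_trans (hD _ _ Bp Bq)).
  rewrite -scalerBr enorm2Z gtr0_norm//.
  apply: (@le_trans _ _ (n * (38 / n * tdist p q))).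
    apply: ler_pM => //; [exact: ltW|exact: l2_ge0|exact: omega_le|].
    exact: enorm2_ray_le.
  by rewrite le_eqVlt; apply/orP; left; apply/eqP; field; rewrite lt0r_neq0.
move=> h; rewrite -lee_fin; apply: le_trans h.
rewrite expr2 EFinM; apply: lee_pmul.
- by rewrite lee_fin; lra.
- by rewrite lee_fin; lra.
- by apply: le_trans c1; rewrite lee_fin; lra.
- by apply: le_trans c3; rewrite lee_fin; lra.
Qed.

Lemma ln2_ge_half : 2^-1 <= ln 2 :> R.
Proof.
rewrite -ler_expR lnK ?posrE//.
have := expR_ge1Dx (- 2^-1 : R); rewrite expRN => h.
have e0 := expR_gt0 (2^-1 : R).
have := mulVf (lt0r_neq0 e0); nra.
Qed.

(** Otherwise [gap_bound] holds with D = - 2800 ln eps, that is,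
D <= 608 (1/4 + 2 ln 2 - 2 ln eps) with 608 = 38 * 16. As 1/2 <= ln 2 <= - ln eps,
the right-hand side is at most - 2736 ln eps. *)
Lemma max_dist_le m (eps : R) : (0 < m)%N -> 0 < eps -> eps < 1 / 2 ->
  (expR 2^-1 / 2) ^+ m.+1 <= eps / 4 ->
  2 * expR (4^-1 - Num.sqrt m.+1%:R / 16) <= eps / 4 ->
  (max_dist m.+1 eps <= (- 2800 * ln eps)%:E)%E.
Proof.
move=> m0 e0 e1 d1 d2; apply: ge_ereal_sup => _ [A hA [B hB <-]].
have [B1 [mB1 B1c v1 A1]] := subsets_of_volume_corner m0 hA.
have [B2 [mB2 B2c v2 A2]] := subsets_of_volume_corner m0 hB.
rewrite leNgt; apply/negP => hd.
set D := - 2800 * ln eps in hd.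
have hD s t : B1 s -> B2 t ->
    D <= enorm2 (omega R m.+1 *: simplex_point s - omega R m.+1 *: simplex_point t).
  move=> Bs Bt; rewrite -lee_fin; apply: (le_trans (ltW hd)).
  apply: ereal_inf_lbound; exists (omega R m.+1 *: simplex_point s); first exact: A1.
  by exists (omega R m.+1 *: simplex_point t) => //; exact: A2.
have := gap_bound m0 mB1 mB2 B1c B2c v1 v2 hD e0 d1 d2.
have -> : (eps / 2) ^+ 2 = expR (2 * (ln eps - ln 2)).
  by rewrite -ln_div ?posrE// expRM_natl lnK// posrE divr_gt0.
rewrite ler_expR /D.
have l2 := ln2_ge_half; have : ln eps <= - ln 2.
  by rewrite -lnV ?posrE// ler_ln ?posrE//; lra.
lra.
Qed.

Lemma limn_esup_max_dist (eps : R) : 0 < eps -> eps < 1 / 2 ->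
  (limn_esup (fun n : nat => max_dist n eps) <= (- 2800 * ln eps)%:E)%E.
Proof.
move=> e0 e1; apply: limn_esup_le.
have q1 : `|expR 2^-1 / 2| < 1 :> R.
  rewrite ger0_norm ?divr_ge0 ?expR_ge0// ltr_pdivrMr// mul1r.
  have := @expR_gt1Dx R (- 2^-1); rewrite expRN => /(_ _) h.
  have e2 := expR_gt0 (2^-1 : R).
  have := mulVf (lt0r_neq0 e2); have : 1 + - 2^-1 < (expR 2^-1)^-1 :> R by apply: h; lra.
  nra.
have h1 : \forall n \near \oo, (expR 2^-1 / 2) ^+ n <= eps / 4.
  have := cvg_expr q1 => /cvgrPdist_lt /(_ (eps / 4)).
  rewrite divr_gt0// => /(_ isT); apply: filterS => n.
  by rewrite sub0r normrN => /ltW; apply: le_trans; exact: ler_norm.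
pose K := 16 * (4^-1 + ln (8 / eps)).
have h2 := nbhs_infty_ger (K ^+ 2).
suff main n : (1 < n)%N -> (expR 2^-1 / 2) ^+ n <= eps / 4 -> K ^+ 2 <= n%:R ->
    (max_dist n eps <= (- 2800 * ln eps)%:E)%E.
  near=> n; apply: main; first by near: n; exists 2.
    by near: n.
  by near: n.
case: n => // m m0 hn1 hn2.
apply: max_dist_le => //.
have : K <= Num.sqrt m.+1%:R.
  by apply: le_trans (ler_norm _) _; rewrite -sqrtr_sqr ler_wsqrtr.
rewrite /K => hK.
apply: (@le_trans _ _ (2 * expR (- ln (8 / eps)))).
  by rewrite ler_wpM2l// ler_expR; lra.
rewrite expRN lnK ?posrE ?divr_gt0// invf_div.
by rewrite le_eqVlt; apply/orP; left; apply/eqP; field.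
Unshelve. all: by end_near. Qed.

End upper.

Theorem mainTheorem3 (R : realType) :
  exists c : R, 0 < c /\
    forall eps : R, 0 < eps -> eps < 1 / 2 ->
      [/\ ((- (Num.sqrt 2 / expR 1) * ln (2 * eps))%:E
             <= limn_einf (fun n : nat => max_dist n eps))%E,
          (limn_einf (fun n : nat => max_dist n eps)
             <= limn_esup (fun n : nat => max_dist n eps))%E &
          (limn_esup (fun n : nat => max_dist n eps)
             <= (- c * ln eps)%:E)%E].
Proof.
exists 2800; split; first by rewrite ltr0n.
move=> eps e0 e1; split.
- exact: limn_einf_max_dist.
- exact: limn_einf_sup.
- exact: limn_esup_max_dist.
Qed.
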